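(* Let $k$ be a field, let $\Gamma\subset\mathbb{P}^r_k$ be an integral non-degenerate projective curve, and let $W\subset\operatorname{Sing}(\Gamma)$ be a set of singular points of $\Gamma$. Then the local Gorenstein adjoint ideals satisfy $$\mathfrak{G}(W)=\bigcap_{P\in W}\mathfrak{G}(P).$$
   Context: Points are closed points. $S=k[X_0,\dots,X_r]$ is the homogeneous coordinate ring of $\mathbb{P}^r_k$, $I(\Gamma)\subset S$ the homogeneous ideal of $\Gamma$, $k[\Gamma]=S/I(\Gamma)$, and $\operatorname{Sing}(\Gamma)$ the set of singular points of $\Gamma$. For a homogeneous ideal $I\subset S$ and a point $P\in\Gamma$, $I_P$ denotes the ideal of the local ring $\mathcal{O}_{\Gamma,P}$ obtained by mapping $I$ to $k[\Gamma]$ and taking the homogeneous localization at $P$. For a reduced Noetherian ring $A$ with normalization $\overline{A}$ (integral closure in its total ring of fractions), the conductor is $\mathcal{C}_A=\{a\in A\mid a\overline{A}\subset A\}$. For $W\subset\operatorname{Sing}(\Gamma)$, the local Gorenstein adjoint ideal $\mathfrak{G}(W)\subset S$ of $\Gamma$ at $W$ is the largest homogeneous ideal of $S$ satisfying $\mathfrak{G}(W)_P=\mathcal{C}_{\mathcal{O}_{\Gamma,P}}$ for all $P\in W$. For a single point, $\mathfrak{G}(P):=\mathfrak{G}(\{P\})$. *)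

(* Defs.v *)
From HB Require Import structures.
From mathcomp Require Import all_boot all_order all_algebra.
From mathcomp Require Import ring_quotient fraction.
From mathcomp Require Import boolp classical_sets.
From mathcomp.multinomials Require Import mpoly.

Set Implicit Arguments.
Unset Strict Implicit.
Unset Printing Implicit Defensive.

Import GRing.Theory.
Local Open Scope ring_scope.
Local Open Scope quotient_scope.
Local Open Scope classical_set_scope.

(* ring_quotient.v makes the quotient by a prime ideal a commutative ring but
   not an integral domain, because it has no test for units: take the classical
   one. *)
Section QuotientIdomain.
Variables (R : comNzRingType) (I : prime_idealr R).
Local Notation Q := {ideal_quot I}.

Definition quot_unit : pred Q := fun x => `[< exists y, y * x = 1 >].

Definition quot_inv (x : Q) : Q :=
  if pselect (exists y, y * x = 1) is left e then projT1 (cid e) else x.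

Lemma quot_mulVr : {in quot_unit, left_inverse 1 quot_inv *%R}.
Proof.
move=> x /asboolP ux; rewrite /quot_inv; case: pselect => // e.
by case: (cid e).
Qed.

Lemma quot_unitP (x y : Q) : y * x = 1 -> quot_unit x.
Proof. by move=> yx; apply/asboolP; exists y. Qed.

Lemma quot_inv_out : {in [predC quot_unit], quot_inv =1 id}.
Proof.
move=> x /negP nux; rewrite /quot_inv; case: pselect => // e.
by case: nux; apply/asboolP.
Qed.

HB.instance Definition _ :=
  GRing.ComNzRing_hasMulInverse.Build Q quot_mulVr quot_unitP quot_inv_out.

HB.instance Definition _ :=
  GRing.ComUnitRing_isIntegral.Build Q (@Quotient.rquot_IdomainAxiom R I).
End QuotientIdomain.

(* A subring is given by its set [A] of elements in an ambient ring; for the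
   ambient ring itself, [A] is [setT]. *)
Section Subrings.
Variable R : comNzRingType.
Implicit Types (A J : set R) (X : set (set R)).

Definition is_ideal A J : Prop :=
  [/\ J `<=` A, J 0, (forall x y, J x -> J y -> J (x + y))
    & (forall a x, A a -> J x -> J (a * x))].

Definition is_prime A J : Prop :=
  [/\ is_ideal A J, ~ J 1
    & (forall x y, A x -> A y -> J (x * y) -> J x \/ J y)].

Definition has_chain X (d : nat) : Prop :=
  exists c : nat -> set R,
    (forall i, (i <= d)%N -> X (c i)) /\
    (forall i, (i < d)%N -> c i `<` c i.+1).

Definition chain_dim X (d : nat) : Prop := has_chain X d /\ ~ has_chain X d.+1.

Definition nonunits A : set R :=
  [set a | A a /\ ~ (exists2 b, A b & a * b = 1)].

(* For a Noetherian local ring [A], whose maximal ideal is [nonunits A]: the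
   maximal ideal has a generating family of [dim A] elements. *)
Definition is_regular_local A : Prop :=
  exists2 d, chain_dim (is_prime A) d &
    exists x : 'I_d -> R,
      (forall i, nonunits A (x i)) /\
      (forall y, nonunits A y -> exists2 a : 'I_d -> R,
         (forall i, A (a i)) & y = \sum_(i < d) a i * x i).
End Subrings.

(* A domain [A] given as a subring of a field [K]: its total ring of fractions
   is its field of fractions, formed inside [K]. *)
Section Conductor.
Variable K : fieldType.
Implicit Types A : set K.

Definition total_fractions A : set K :=
  [set z | exists a b, [/\ A a, A b, b != 0 & z = a / b]].

Definition normalization A : set K :=
  [set z | total_fractions A z /\
     exists p : {poly K}, [/\ p \is monic, (forall i, A p`_i) & root p z]].

Definition conductor A : set K :=
  [set a | A a /\ forall z, normalization A z -> A (a * z)].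
End Conductor.

(* An integral closed subscheme of P^r is given by its homogeneous ideal [I], a
   homogeneous prime ideal of S that does not contain all the variables.  Its
   points are the ideals of the same kind that contain [I]. *)
Section ProjectiveCurve.
Variables (k : fieldType) (r : nat).
Local Notation S := {mpoly k[r.+1]}.
Implicit Types (J P G : set S) (W : set (set S)).

Definition homogeneous_ideal J : Prop :=
  is_ideal setT J /\ forall f d, J f -> J (pihomog mdeg d f).

Variable I : prime_idealr S.
Local Notation kG := {ideal_quot I}.
Local Notation K := {fraction kG}.

Definition proj_points : set (set S) :=
  [set P | [/\ homogeneous_ideal P, is_prime setT P,
     [set f | f \in I] `<=` P & exists i, ~ P 'X_i]].

Definition integral_curve : Prop :=
  proj_points [set f | f \in I] /\ chain_dim proj_points 1.

Definition nondegenerate_curve : Prop :=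
  forall f : S, f \in I -> f \is 1.-homog -> f = 0.

Definition closed_points : set (set S) :=
  [set P | proj_points P /\ forall Q, proj_points Q -> P `<=` Q -> Q = P].

Definition cfrac (f g : S) : K :=
  @FracField.tofrac kG (\pi f) / @FracField.tofrac kG (\pi g).

(* The homogeneous localization at [P] of the image of [J] in k[Gamma], as a
   subset of the field of fractions of k[Gamma]. *)
Definition local_ideal P J : set K :=
  [set z | exists d f g,
     [/\ J f, f \is d.-homog, g \is d.-homog, ~ P g & z = cfrac f g]].

Definition local_ring P : set K := local_ideal P setT.

Definition singular_points : set (set S) :=
  [set P | closed_points P /\ ~ is_regular_local (local_ring P)].

Definition is_local_adjoint W J : Prop :=
  homogeneous_ideal J /\
  forall P, W P -> local_ideal P J = conductor (local_ring P).

Definition is_gorenstein_adjoint W G : Prop :=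
  is_local_adjoint W G /\ forall J, is_local_adjoint W J -> J `<=` G.

(* [xget] picks the element, unique by [gorenstein_adjoint_eq] below, that
   satisfies the description; its default value [set0] is not an ideal. *)
Definition gorenstein_adjoint W : set S :=
  xget set0 [set G | is_gorenstein_adjoint W G].

Lemma gorenstein_adjoint_eq W G :
  is_gorenstein_adjoint W G -> gorenstein_adjoint W = G.
Proof.
move=> [adjG maxG]; rewrite /gorenstein_adjoint.
apply: xget_unique => // G' [adjG' maxG'].
by apply/seteqP; split; [exact: maxG|exact: maxG'].
Qed.
End ProjectiveCurve.

(* Main.v *)
(* Let G(W) be the set of the polynomials f such that, for every P in W, each
   homogeneous component of f divided by any form of the same degree not
   vanishing at P lies in the conductor at P.  It is a homogeneous ideal, it
   contains every ideal whose localizations at W are the conductors, and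
   visibly G(W) is the intersection of the G({P}).  So all that matters is that
   G(W) localizes to the whole conductor at each P in W.

   For this we produce a form C, nonzero on the curve, that lies in the
   conductor at every point.  At each P there is then a form t, not vanishing at
   P, such that t p^n is a multiple of C for enough forms p vanishing at P (no
   prime lies strictly between the curve and P).  At a point Q other than P some
   such p is invertible, so t lies in the conductor at Q; hence any element f/g
   of the conductor at P is tf/tg with tf in G(W).

   The form C comes from the finiteness of normalization on two charts, proved
   without separability as in the theory of the genus.  Let A be a chart, finite
   over k[x], of rank n, and let L(d) be the space of the elements z of its
   normalization for which z/x^d is integral over k[1/x].  Then x L(d-1) has
   codimension at most n in L(d), and L(-1) = 0, so dim L(d) <= n(d+1); a free
   k[x]-module of rank n inside A already fills L(d) up to a codimension
   bounded independently of d. *)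

From HB Require Import structures.
Require Import Defs.
From mathcomp Require Import all_boot all_order all_algebra.
From mathcomp Require Import ring_quotient fraction.
From mathcomp Require Import boolp classical_sets.
From mathcomp Require Import zify ring.
From mathcomp.multinomials Require Import mpoly.

Set Implicit Arguments.
Unset Strict Implicit.
Unset Printing Implicit Defensive.

Import Order.TTheory GRing.Theory.
Local Open Scope ring_scope.
Local Open Scope quotient_scope.
Local Open Scope classical_set_scope.

(** * Linear dependence over a domain *)

Section Span.
Variables (D K : comNzRingType) (f : {rmorphism D -> K}).

Definition lincomb (J : finType) (a : J -> K) : set K :=
  [set z | exists c : J -> D, z = \sum_j f (c j) * a j].

Lemma lincomb0 (J : finType) (a : J -> K) : lincomb a 0.
Proof. by exists (fun=> 0); rewrite big1 // => j _; rewrite rmorph0 mul0r. Qed.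

Lemma lincombD (J : finType) (a : J -> K) u v :
  lincomb a u -> lincomb a v -> lincomb a (u + v).
Proof.
move=> [c ->] [d ->]; exists (fun j => c j + d j).
by rewrite -big_split; apply: eq_bigr => j _; rewrite rmorphD mulrDl.
Qed.

Lemma lincombZ (J : finType) (a : J -> K) b u : lincomb a u -> lincomb a (f b * u).
Proof.
move=> [c ->]; exists (fun j => b * c j).
by rewrite mulr_sumr; apply: eq_bigr => j _; rewrite rmorphM mulrA.
Qed.

Lemma lincomb_id (J : finType) (a : J -> K) j : lincomb a (a j).
Proof.
exists (fun i => (i == j)%:R); rewrite (bigD1 j) //= eqxx rmorph1 mul1r.
by rewrite big1 ?addr0 // => i /negPf->; rewrite rmorph0 mul0r.
Qed.

Lemma lincomb_sum (J : finType) (a : J -> K) (T : Type)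
    (s : seq T) (P : pred T) (F : T -> K) :
  (forall i, P i -> lincomb a (F i)) -> lincomb a (\sum_(i <- s | P i) F i).
Proof. by move=> h; apply: big_ind => //; [exact: lincomb0|exact: lincombD]. Qed.

End Span.

Lemma common_denominator (D : idomainType) (I : finType)
    (u : I -> {fraction D}) :
  exists d : D, exists w : I -> D,
    d != 0 /\ forall i, @FracField.tofrac D (w i) = @FracField.tofrac D d * u i.
Proof.
have h i : exists n, exists d : D, d != 0 /\
    @FracField.tofrac D n = @FracField.tofrac D d * u i.
  elim/quotW: (u i) => x; exists (frac x).1, (frac x).2.
  split; first exact: denom_ratioP.
  rewrite -[RHS]/(FracField.mul _ _) !piE.
  apply/eqmodP; rewrite /= FracField.equivfE.
  by rewrite !numden_Ratio ?(oner_eq0, mulf_neq0, denom_ratioP) // !mul1r mulrC.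
have /choice [n /choice [d hd]] := h.
exists (\prod_i d i), (fun i => (\prod_(j | j != i) d j) * n i); split.
  by apply/prodf_neq0 => i _; have [] := hd i.
move=> i; have [_ e] := hd i.
by rewrite [\prod_i d i](bigD1 i) //= !tofracM e mulrA [X in X * _]mulrC.
Qed.

(** The coefficients form a matrix over the fractions of [D] with more rows than columns, so its
    left kernel is nonzero; clearing denominators brings a kernel vector into [D]. *)
Lemma dependent_span (D : idomainType) (K : comNzRingType)
    (f : {rmorphism D -> K}) (I J : finType) (a : J -> K) (v : I -> K) :
  (#|J| < #|I|)%N -> (forall i, lincomb f a (v i)) ->
  exists2 p : I -> D, (exists i, p i != 0) & \sum_i f (p i) * v i = 0.
Proof.
move=> ltJI /choice [c hc].
pose C : 'M[{fraction D}]_(#|I|, #|J|) :=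
  \matrix_(i, j) @FracField.tofrac D (c (enum_val i) (enum_val j)).
have : kermx C != 0.
  rewrite -mxrank_eq0 mxrank_ker subn_eq0 -ltnNge.
  exact: leq_ltn_trans (rank_leq_col C) ltJI.
move=> /rowV0Pn [u /sub_kermxP uC u0].
have [d [w [d0 hw]]] := common_denominator (fun i : I => u 0 (enum_rank i)).
exists w.
  have [i ui] := rV0Pn _ u0; exists (enum_val i).
  rewrite -tofrac_eq0 hw enum_valK mulf_neq0 // tofrac_eq0 //.
have wc j : \sum_i w i * c i j = 0.
  apply/eqP; rewrite -tofrac_eq0 rmorph_sum /=; apply/eqP.
  transitivity (@FracField.tofrac D d * (u *m C) 0 (enum_rank j)); last first.
    by rewrite uC mxE mulr0.
  rewrite mxE mulr_sumr (reindex (fun i : 'I_#|I| => enum_val i)) /=; last first.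
    exact/onW_bij/enum_val_bij.
  by apply: eq_bigr => i _; rewrite rmorphM /= hw mxE enum_valK enum_rankK mulrA.
transitivity (\sum_j f (\sum_i w i * c i j) * a j); last first.
  by rewrite big1 // => j _; rewrite wc rmorph0 mul0r.
under eq_bigr do rewrite hc mulr_sumr.
rewrite exchange_big; apply: eq_bigr => j _ /=; rewrite rmorph_sum mulr_suml.
by apply: eq_bigr => i _; rewrite rmorphM mulrA.
Qed.

(** The determinant trick: the vector of the [a j] is killed by [z - A], hence by its determinant,
    which is the characteristic polynomial of [A] at [z]. *)
Lemma integral_stable_span (R : comNzRingType) (K : fieldType)
    (f : {rmorphism R -> K}) (J : finType) (a : J -> K) z :
  (exists j, a j != 0) -> (forall j, lincomb f a (z * a j)) -> integralOver f z.
Proof.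
move=> [j0 aj0] /choice [c hc].
pose A : 'M[R]_#|J| := \matrix_(i, j) c (enum_val i) (enum_val j).
pose u : 'cV[K]_#|J| := \col_i a (enum_val i).
pose B := z%:M - map_mx f A.
have Bu : B *m u = 0.
  apply/eqP; rewrite mulmxBl mul_scalar_mx subr_eq0; apply/eqP/colP => i.
  rewrite !mxE hc (reindex (fun i : 'I_#|J| => enum_val i)) /=; last first.
    exact/onW_bij/enum_val_bij.
  by apply: eq_bigr => j _; rewrite !mxE.
exists (char_poly A); first exact: char_poly_monic.
have detB : \det B = 0.
  have : \det B *: u = 0 by rewrite -mul_scalar_mx -mul_adj_mx -mulmxA Bu mulmx0.
  move=> /colP /(_ (enum_rank j0)); rewrite !mxE enum_rankK => /eqP.
  by rewrite mulf_eq0 (negPf aj0) orbF => /eqP.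
rewrite rootE -horner_evalE -2!det_map_mx; apply/eqP; rewrite -detB.
congr (\det _); rewrite raddfB/= map_scalar_mx; apply/matrixP => i j.
by rewrite !mxE raddfB raddfMn /= map_polyX map_polyC /horner_eval !hornerE.
Qed.

Lemma lift_max_widen n (i : 'I_n) : lift ord_max i = widen_ord (leqnSn n) i.
Proof. by apply: val_inj; exact: lift_max. Qed.

Section Spanning.
Variables (k K : fieldType) (f : {rmorphism k -> K}).

(** If some [n] elements of [V] are independent modulo [L], any [z] has a nonzero coefficient in a
    relation with them and can be solved for; otherwise [n] can be lowered. Stability of [L] under
    scalars suffices, since only one element of it is ever rescaled. *)
Lemma span_mod_of_dependent n (V L : set K) : V 0 -> L 0 ->
  (forall a u, L u -> L (f a * u)) ->
  (forall v : 'I_n.+1 -> K, (forall i, V (v i)) ->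
     exists2 p : 'I_n.+1 -> k, (exists i, p i != 0)
       & L (\sum_i f (p i) * v i)) ->
  exists2 b : 'I_n -> K, (forall i, V (b i))
    & forall z, V z -> exists p : 'I_n -> k, L (z - \sum_i f (p i) * b i).
Proof.
move=> V0 L0 LZ; elim: n => [|n IHn] dep.
  exists (fun=> 0) => // z Vz; exists (fun=> 0); rewrite big_ord0 subr0.
  have [p [i pi0]] := dep (fun=> z) (fun=> Vz).
  rewrite big_ord1 ord1 in pi0 * => /(LZ (p ord0)^-1).
  by rewrite mulrA -rmorphM mulVf // rmorph1 mul1r.
have [|] := pselect (forall v : 'I_n.+1 -> K, (forall i, V (v i)) ->
     exists2 p : 'I_n.+1 -> k, (exists i, p i != 0)
       & L (\sum_i f (p i) * v i)).
  move=> /IHn [b Vb hb].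
  exists (fun i => oapp b 0 (unlift ord_max i)) => [i|z /hb [p hp]].
    by case: unliftP => [j|] _ /=.
  exists (fun i => oapp p 0 (unlift ord_max i)).
  rewrite big_ord_recr /= unlift_none /= mulr0 addr0.
  rewrite [X in z - X](_ : _ = \sum_i f (p i) * b i) //.
  by apply: eq_bigr => i _; rewrite -lift_max_widen liftK.
move=> /existsNP [b /not_implyP [Vb nb]]; exists b => // z Vz.
have [|p [i pi0]] := dep (fun i => oapp b z (unlift ord_max i)).
  by move=> i; case: unliftP => [j|] _ /=.
rewrite big_ord_recr /= unlift_none /=.
under eq_bigr => j _ do rewrite -lift_max_widen liftK /=.
have [pz|pz] := eqVneq (p ord_max) 0.
  rewrite pz rmorph0 mul0r addr0 => Lp; case: nb.
  exists (fun j => p (lift ord_max j)) => //.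
  case: (unliftP ord_max i) pi0 => [j ->|->]; first by exists j.
  by rewrite pz eqxx.
move=> /(LZ (p ord_max)^-1); rewrite mulrDr mulrA -rmorphM mulVf // rmorph1 mul1r.
rewrite addrC mulr_sumr => Lz.
exists (fun j => - ((p ord_max)^-1 * p (lift ord_max j))).
rewrite -sumrN (eq_bigr
  (fun j => f (p ord_max)^-1 * (f (p (lift ord_max j)) * b j))) // => j _.
by rewrite rmorphN mulNr opprK rmorphM mulrA.
Qed.

End Spanning.

(** * Integrality over [k[x]] and [k[1/x]] *)

Lemma integral_sum (R K : comNzRingType) (f : {rmorphism R -> K}) (T : Type)
    (s : seq T) (P : pred T) (F : T -> K) :
  (forall i, P i -> integralOver f (F i)) ->
  integralOver f (\sum_(i <- s | P i) F i).
Proof.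
move=> h; apply: big_ind => //; first exact: integral0.
by move=> u v; exact: integral_add.
Qed.

Lemma size_map_monic (R K : nzRingType) (f : {rmorphism R -> K}) (p : {poly R}) :
  p \is monic -> size (map_poly f p) = size p.
Proof.
by move=> /monicP p1; rewrite size_map_poly_id0 // p1 rmorph1 oner_neq0.
Qed.

(** With [N] the degree of [p], [q] is [y^N p(X/y)] written without division. *)
Lemma scale_monic_root (K : comNzRingType) (p : {poly K}) (y z : K) :
  p \is monic -> root p z ->
  let q := \poly_(i < size p) (p`_i * y ^+ ((size p).-1 - i)) in
  q \is monic /\ root q (y * z).
Proof.
move=> mon_p pz; set N := (size p).-1; move=> q.
have sp : size p = N.+1 by rewrite /N prednK // size_poly_gt0 monic_neq0.
have pN : p`_N = 1 by rewrite -(monicP mon_p).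
have sq : size q = N.+1.
  by rewrite /q sp size_poly_eq // pN subnn mulr1 oner_neq0.
split; first by rewrite monicE lead_coefE sq coef_poly sp ltnSn pN subnn mulr1.
suff e : q.[y * z] = y ^+ N * p.[z] by rewrite rootE e (rootP pz) mulr0.
rewrite !horner_coef sq sp mulr_sumr; apply: eq_bigr => i _.
have iN : (i <= N)%N by rewrite -ltnS.
rewrite coef_poly sp ltn_ord exprMn -[X in _ = y ^+ X * _](subnK iN) exprD.
by rewrite !mulrA [p`_i * _]mulrC [_ * p`_i * _]mulrAC.
Qed.

Lemma integral_exp (R K : comNzRingType) (f : {rmorphism R -> K}) u n :
  integralOver f u -> integralOver f (u ^+ n).
Proof.
move=> h; elim: n => [|n IHn]; first exact: integral1.
by rewrite exprS; exact: integral_mul.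
Qed.

(** The exponent [M] is free above a bound so that two equations for the same [z], over k[x] and
    over k[1/x], can be given one degree. *)
Lemma integral_expn_sum (R K : comNzRingType) (f : {rmorphism R -> K}) z :
  integralOver f z -> exists N, forall M, (N <= M)%N ->
    exists c : 'I_M -> R, z ^+ M = \sum_(i < M) f (c i) * z ^+ i.
Proof.
move=> [p mon_p pz]; exists (size p).-1 => M NM.
pose P := p * 'X^(M - (size p).-1).
have mon_P : P \is monic by rewrite monicMr ?monicXn.
have sP : size P = M.+1.
  have : (0 < size p)%N by rewrite size_poly_gt0 monic_neq0.
  by rewrite size_monicM ?monic_neq0 ?monicXn // size_polyXn; lia.
exists (fun i => - P`_i).
have : (map_poly f P).[z] = 0 by rewrite rmorphM hornerM (rootP pz) mul0r.
rewrite horner_coef size_map_monic // sP big_ord_recr /= coef_map.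
rewrite [X in _ + X * z ^+ M](_ : _ = 1); last first.
  by move/monicP: mon_P; rewrite /lead_coef sP /= => ->; exact: rmorph1.
rewrite mul1r => /eqP; rewrite addrC addr_eq0 => /eqP ->; rewrite -sumrN.
by apply: eq_bigr => i _; rewrite coef_map rmorphN mulNr.
Qed.

Section Evaluation.
Variables (k K : fieldType) (iota : {rmorphism k -> K}).

Fact commr_field (y : K) : commr_rmorph iota y.
Proof. by move=> a; exact: mulrC. Qed.

Notation ev y := (horner_morph (commr_field y)).

Lemma evE y (p : {poly k}) : ev y p = \sum_(i < size p) iota p`_i * y ^+ i.
Proof.
rewrite /horner_morph horner_coef size_map_poly.
by apply: eq_bigr => i _; rewrite coef_map.
Qed.

Lemma ev_poly y n (c : nat -> k) :
  ev y (\poly_(i < n) c i) = \sum_(i < n) iota (c i) * y ^+ i.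
Proof.
rewrite poly_def rmorph_sum /=; apply: eq_bigr => i _.
by rewrite -mul_polyC rmorphM rmorphXn /= horner_morphC horner_morphX.
Qed.

Lemma relation_poly n (p : 'I_n -> k) : (exists i, p i != 0) ->
  exists2 P : {poly k}, P != 0 & forall y, ev y P = \sum_i iota (p i) * y ^+ i.
Proof.
move=> [i pi0]; exists (rVpoly (\row_i p i)).
  apply/eqP => /(congr1 (fun q : {poly k} => q`_i)).
  by rewrite coef_rVpoly_ord mxE coef0; apply/eqP.
move=> y; rewrite /horner_morph (@horner_coef_wide _ n); last first.
  by rewrite size_map_poly size_poly.
by apply: eq_bigr => j _; rewrite coef_map coef_rVpoly_ord mxE.
Qed.

Lemma integral_ev_id y : integralOver (ev y) y.
Proof. by have /= := integral_id (ev y) 'X; rewrite horner_morphX. Qed.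

Lemma integral_ev_const y a : integralOver (ev y) (iota a).
Proof. by have /= := integral_id (ev y) a%:P; rewrite horner_morphC. Qed.

Variable x : K.

Lemma integral_ev_inv (p : {poly k}) m :
  x != 0 -> (size p <= m.+1)%N -> integralOver (ev x^-1) (ev x p / x ^+ m).
Proof.
move=> x0 sp; rewrite evE mulr_suml; apply: integral_sum => i _.
have im : (i <= m)%N by exact: leq_trans (ltn_ord i) sp.
rewrite -mulrA -(subnK im) exprD invfM [_^-1 * _]mulrC mulVKf ?expf_neq0 //.
rewrite -exprVn; apply: integral_mul; first exact: integral_ev_const.
exact/integral_exp/integral_ev_id.
Qed.

Hypothesis x_tr : ~ algebraicOver iota x.

Lemma transcendental_neq0 : x != 0.
Proof. by apply/eqP => x0; apply: x_tr; rewrite x0; exact: algebraic0. Qed.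

Let x0 := transcendental_neq0.

(** With [n] bounding the sizes of the coefficients, dividing [z] by [x^n] divides the coefficient
    of index [i < N] by [x^(n(N-i))], which lands in k[1/x]. *)
Lemma integral_div_expn z : integralOver (ev x) z ->
  exists n, integralOver (ev x^-1) (z / x ^+ n).
Proof.
move=> [p mon_p pz]; pose n := (\max_(i < size p) size (p`_i)%R)%N.
exists n; rewrite mulrC.
have [mon_q qz] := scale_monic_root (x ^- n) (monic_map (ev x) mon_p) pz.
apply: integral_root_monic mon_q qz _; apply/integral_poly => i.
rewrite coef_poly size_map_monic //; case: ltnP => [ip|_]; last exact: integral0.
have [->|iN] := eqVneq i (size p).-1.
  rewrite subnn mulr1 coef_map -lead_coefE (monicP mon_p).
  by rewrite [X in integralOver _ X]rmorph1; exact: integral1.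
rewrite coef_map exprVn -exprM; apply: integral_ev_inv => //.
apply: leqW; apply: (@leq_trans n); last by rewrite leq_pmulr //; lia.
exact: (@leq_bigmax _ (fun i : 'I_(size p) => size (p`_i)%R) (Ordinal ip)).
Qed.

(** Dividing an integral equation of degree [N] by [x^N] gives a polynomial relation for 1/x with
    constant term 1, contributed by the leading coefficient; so 1/x would be algebraic. *)
Lemma integral_inv_transcendental :
  ~ integralOver (ev x^-1) x.
Proof.
move=> [p mon_p]; rewrite rootE => /eqP px.
set N := (size p).-1.
have sp : size p = N.+1 by rewrite /N prednK // size_poly_gt0 monic_neq0.
have ax : algebraicOver iota x^-1.
  exists (\sum_(i < N.+1) p`_i * 'X^(N - i)).
    have cX (j : nat) (q : {poly k}) : (q * 'X^j)`_0 = if j == 0 then q`_0 else 0.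
      by rewrite coefMXn; case: j.
    apply/eqP => /(congr1 (fun q : {poly k} => q`_0)).
    rewrite coef0 coef_sum big_ord_recr /= big1 ?add0r => [|i _]; last first.
      by rewrite cX subn_eq0 leqNgt ltn_ord.
    rewrite cX subnn eqxx /N -lead_coefE (monicP mon_p) coef1 => /eqP.
    by rewrite oner_eq0.
  apply/eqP; rewrite -[LHS]/(ev x^-1 _) rmorph_sum /=.
  transitivity ((map_poly (ev x^-1) p).[x] / x ^+ N); last by rewrite px mul0r.
  rewrite horner_coef size_map_monic // sp mulr_suml; apply: eq_bigr => i _.
  rewrite rmorphM rmorphXn /= horner_morphX coef_map -mulrA; congr (_ * _).
  have iN : (i <= N)%N by rewrite -ltnS.
  by rewrite -[X in _ / x ^+ X](subnK iN) exprD invfM mulrC exprVn mulfVK ?expf_neq0.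
by apply: x_tr; rewrite -[x]invrK; exact: algebraic_inv.
Qed.

(* The products [x^i z^j] with [|i| <= D] and [j <= N] span a space stable under
   [z]: the leading power of [z] is reduced over [k[x]] when [i <= 0] and over
   [k[1/x]] when [i > 0]. *)
Lemma algebraic_of_integral z :
  integralOver (ev x) z -> integralOver (ev x^-1) z -> algebraicOver iota z.
Proof.
move=> /integral_expn_sum [N1 h1] /integral_expn_sum [N2 h2].
pose N := maxn N1 N2.
have [c zc] : exists c : 'I_N.+1 -> {poly k},
    z ^+ N.+1 = \sum_i ev (x) (c i) * z ^+ i := h1 N.+1 (leqW (leq_maxl _ _)).
have [d zd] : exists c : 'I_N.+1 -> {poly k},
    z ^+ N.+1 = \sum_i ev (x^-1) (c i) * z ^+ i := h2 N.+1 (leqW (leq_maxr _ _)).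
pose D := maxn (\max_i size (c i)) (\max_i size (d i)).
have cD i : (size (c i) <= D)%N by rewrite leq_max leq_bigmax.
have dD i : (size (d i) <= D)%N by rewrite leq_max leq_bigmax orbT.
(* The index [s] stands for the exponent [s - D], which runs from [-D] to [D]. *)
pose a (sj : 'I_D.*2.+1 * 'I_N.+1) := x ^+ sj.1 / x ^+ D * z ^+ sj.2.
have memV s j : (s <= D.*2)%N -> (j <= N)%N ->
    lincomb iota a (x ^+ s / x ^+ D * z ^+ j).
  rewrite -ltnS -[(j <= _)%N]ltnS => sD jN.
  by have := lincomb_id iota a (Ordinal sD, Ordinal jN); rewrite {2}/a /=.
have stab u : lincomb iota a u -> lincomb iota a (z * u).
  move=> [e ->]; rewrite mulr_sumr; apply: lincomb_sum => -[[s sD] [j jN]] _ /=.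
  rewrite /a /= mulrCA; apply: lincombZ; rewrite mulrCA -exprS.
  have [{}jN|jN'] := ltnP j N; first exact: memV.
  have -> : j = N by lia.
  have [sD'|sD'] := leqP s D.
    rewrite zc mulr_sumr; apply: lincomb_sum => i _.
    rewrite evE mulrA mulr_sumr mulr_suml; apply: lincomb_sum => t _.
    have tD : (t < D)%N by exact: leq_trans (ltn_ord t) (cD i).
    rewrite [_ * (iota _ * _)]mulrCA -mulrA; apply: lincombZ.
    by rewrite [_ / _ * _]mulrAC -exprD; apply: memV; have := ltn_ord i; lia.
  rewrite zd mulr_sumr; apply: lincomb_sum => i _.
  rewrite evE mulrA mulr_sumr mulr_suml; apply: lincomb_sum => t _.
  have tD : (t < D)%N by exact: leq_trans (ltn_ord t) (dD i).
  rewrite [_ * (iota _ * _)]mulrCA -mulrA; apply: lincombZ.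
  rewrite [_ / _ * _]mulrAC exprVn -expfB; last by lia.
  by apply: memV; have := ltn_ord i; lia.
have Vz i : lincomb iota a (z ^+ i).
  elim: i => [|i IHi]; last by rewrite exprS; exact: stab.
  by have := @memV D 0; rewrite mulfV ?expf_neq0 // mul1r; apply; lia.
have [|p pi0 pz] := @dependent_span _ _ iota
    'I_#|{: 'I_D.*2.+1 * 'I_N.+1}|.+1 _ a (fun i => z ^+ i) _ (fun=> Vz _).
  by rewrite card_ord.
have [P P0 hP] := relation_poly pi0.
by exists P => //; rewrite rootE -[_.[z]]/(ev z P) hP pz.
Qed.

(** Such a [z] has no pole, so it is algebraic over k. Were it nonzero, its inverse would be
    integral over k, and [x], the product of [z^-1] and [z * x], integral over k[1/x]. *)
Lemma integral_both_eq0 z :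
  integralOver (ev x) z -> integralOver (ev x^-1) (z * x) -> z = 0.
Proof.
move=> zx zxy; apply/eqP/negP => /negP z0; apply: integral_inv_transcendental.
have zy : integralOver (ev x^-1) z.
  by rewrite -[z](mulfK x0); apply: integral_mul => //; exact: integral_ev_id.
have [p p0 pz] := algebraic_inv (algebraic_of_integral zx zy).
have /integral_algebraic [q mon_q qz] : algebraicOver iota z^-1 by exists p.
rewrite -[x in integralOver _ x](mulKf z0); apply: integral_mul => //.
exists (map_poly polyC q); first exact: monic_map.
rewrite -map_poly_comp (eq_map_poly (g := iota)) // => a /=.
by rewrite horner_morphC.
Qed.

End Evaluation.

(** * Finiteness of normalization in dimension one *)

Local Notation ev iota y := (horner_morph (commr_field iota y)).

Section FiniteNormalization.
Variables (k K : fieldType) (iota : {rmorphism k -> K}) (x : K) (A : set K).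
Variables (J : finType) (a : J -> K).
Hypothesis x_tr : ~ algebraicOver iota x.
Hypothesis A1 : A 1.
Hypothesis AB : forall u v, A u -> A v -> A (u - v).
Hypothesis AM : forall u v, A u -> A v -> A (u * v).
Hypothesis Aiota : forall c, A (iota c).
Hypothesis Ax : A x.
Hypothesis Aa : forall j, A (a j).
Hypothesis A_span : A `<=` lincomb (ev iota x) a.

Local Notation ev y := (horner_morph (commr_field iota y)).
Local Notation Intx := (integralOver (ev x)).
Local Notation Inty := (integralOver (ev x^-1)).

Let x0 : x != 0 := transcendental_neq0 x_tr.

Let A0 : A 0. Proof. by rewrite -(subrr 1); exact: AB. Qed.

Let AN u : A u -> A (- u). Proof. by move=> Au; rewrite -sub0r; exact: AB. Qed.

Let AD u v : A u -> A v -> A (u + v).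
Proof. by move=> Au Av; rewrite -[v]opprK; exact/AB/AN. Qed.

Let A_sum (T : finType) (F : T -> K) : (forall i, A (F i)) -> A (\sum_i F i).
Proof. by move=> h; apply: big_ind. Qed.

Let A_ev p : A (ev x p).
Proof.
rewrite evE; apply: A_sum => i; apply: AM => //.
by elim: {i}(i : nat) => [|i IHi]; rewrite ?expr0 // exprS; exact: AM.
Qed.

Let A_int z : A z -> Intx z.
Proof.
move=> Az; apply: (@integral_stable_span _ _ _ _ a) => [|j]; last first.
  exact/A_span/AM.
apply/not_existsP => a0; have [c /eqP] := A_span A1.
rewrite big1 ?oner_eq0 // => j _.
by have /negP := a0 j; rewrite negbK => /eqP ->; rewrite mulr0.
Qed.

(** It contains the normalization of [A], because [A] is integral over k[x]. *)
Let V : set K := [set z | total_fractions A z /\ Intx z].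

Let frA z : A z -> total_fractions A z.
Proof. by move=> Az; exists z, 1; rewrite divr1 oner_neq0. Qed.

Let frD u v : total_fractions A u -> total_fractions A v ->
  total_fractions A (u + v).
Proof.
move=> [b [c [Ab Ac c0 ->]]] [d [e [Ad Ae e0 ->]]].
exists (b * e + d * c), (c * e); split; rewrite ?mulf_neq0 ?addf_div //;
  last exact: AM.
by apply: AD; exact: AM.
Qed.

Let frM u v : total_fractions A u -> total_fractions A v ->
  total_fractions A (u * v).
Proof.
move=> [b [c [Ab Ac c0 ->]]] [d [e [Ad Ae e0 ->]]].
by exists (b * d), (c * e); rewrite mulf_neq0 // mulf_div; split=> //; exact: AM.
Qed.

Let VA z : A z -> V z. Proof. by move=> Az; split; [exact: frA|exact: A_int]. Qed.

Let VD u v : V u -> V v -> V (u + v).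
Proof. by move=> [fu iu] [fv iv]; split; [exact: frD|exact: integral_add]. Qed.

Let VM u v : V u -> V v -> V (u * v).
Proof. by move=> [fu iu] [fv iv]; split; [exact: frM|exact: integral_mul]. Qed.

Let V_sum (T : finType) (F : T -> K) : (forall i, V (F i)) -> V (\sum_i F i).
Proof. by move=> h; apply: big_ind => //; exact: VA. Qed.

Let normalization_V z : normalization A z -> V z.
Proof.
move=> [fz [p [mon_p Ap pz]]]; split=> //.
by apply: integral_root_monic mon_p pz _; apply/integral_poly => i; exact: A_int.
Qed.

Let independent n (e : 'I_n -> K) :=
  forall p : 'I_n -> {poly k}, \sum_i ev x (p i) * e i = 0 -> forall i, p i = 0.

Let dependentP n (e : 'I_n -> K) : ~ independent e ->
  exists2 p : 'I_n -> {poly k}, (exists i, p i != 0)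
    & \sum_i ev x (p i) * e i = 0.
Proof.
move=> /existsNP [p /not_implyP [pe /existsNP [i pi]]].
by exists p => //; exists i; apply/eqP.
Qed.

(** Take the largest size [n] of an independent family in [A], bounded by the number of generators.
    Any [n + 1] fractions times a common denominator lie in [A], hence are dependent. *)
Let rank_exists : exists n,
  (exists2 e : 'I_n -> K, (forall i, A (e i)) & independent e) /\
  (forall v : 'I_n.+1 -> K, (forall i, total_fractions A (v i)) ->
     exists2 p : 'I_n.+1 -> {poly k}, (exists i, p i != 0)
       & \sum_i ev x (p i) * v i = 0).
Proof.
pose P n := `[< exists2 e : 'I_n -> K, (forall i, A (e i)) & independent e >].
have P0 : exists n, P n by exists 0%N; apply/asboolP; exists (fun=> 0) => // p _ [].
have Pb n : P n -> (n <= #|J|)%N.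
  move=> /asboolP [e Ae ie]; rewrite leqNgt; apply/negP => ltJn.
  have [|p [i pi0] pe] :=
      @dependent_span _ _ (ev x) 'I_n J a e _ (fun i => A_span (Ae i)).
    by rewrite card_ord.
  by rewrite (ie p pe i) eqxx in pi0.
have [n /asboolP Pn maxn] := ex_maxnP P0 Pb; exists n; split=> // v fv.
have /choice [b hb] : forall i, exists b, [/\ A b, b != 0 & A (b * v i)].
  move=> i; have [c [b [Ac Ab b0 ->]]] := fv i; exists b.
  by rewrite mulrC divfK.
pose B := \prod_i b i.
have B0 : B != 0 by apply/prodf_neq0 => i _; have [] := hb i.
have ABv i : A (B * v i).
  rewrite /B (bigD1 i) //= mulrAC mulrC; apply: AM; last by have [] := hb i.
  by apply: big_ind => // j _; have [] := hb j.
have [|p pi0 pe] := @dependentP _ (fun i => B * v i).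
  move=> iv; suff : (n.+1 <= n)%N by rewrite ltnn.
  by apply: maxn; apply/asboolP; exists (fun i => B * v i).
exists p => //; apply: (mulfI B0); rewrite mulr0 mulr_sumr -[RHS]pe.
by apply: eq_bigr => i _; rewrite mulrCA.
Qed.

(* The space written [L(d - 1)] in the introduction: the shift avoids a negative
   index. *)
Let L d : set K := [set z | V z /\ Inty (z * x / x ^+ d)].

Let L_le d d' z : (d <= d')%N -> L d z -> L d' z.
Proof.
move=> dd' [Vz iz]; split=> //; rewrite -(subnK dd') exprD invfM mulrCA -exprVn.
by apply: integral_mul => //; exact/integral_exp/integral_ev_id.
Qed.

Let V_L z : V z -> exists d, L d z.
Proof.
move=> Vz; have [m im] := integral_div_expn x_tr Vz.2; exists m.+1; split=> //.
by rewrite exprS invfM -mulrA mulVKf.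
Qed.

Let V_L_fin n (v : 'I_n -> K) : (forall i, V (v i)) -> exists d, forall i, L d (v i).
Proof.
move=> Vv; have /choice [d hd] := fun i => V_L (Vv i).
by exists (\max_i d i)%N => i; exact: L_le (leq_bigmax i) (hd i).
Qed.

Let L0_eq0 z : L 0 z -> z = 0.
Proof. by move=> [[_ iz]]; rewrite expr0 divr1; exact: integral_both_eq0. Qed.

Let poly_takeX0 (p : {poly k}) : p = (p`_0)%:P + drop_poly 1 p * 'X.
Proof.
rewrite -{1}(poly_take_drop 1 p) expr1; congr (_ + _).
apply/polyP => i; rewrite coef_take_poly coefC.
by case: i.
Qed.

(** Divide by [X] while all constant terms vanish; the size of one fixed nonzero coefficient drops
    each time. *)
Let strip_X n (v : 'I_n -> K) (p : 'I_n -> {poly k}) :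
  (exists i, p i != 0) -> \sum_i ev x (p i) * v i = 0 ->
  exists2 q : 'I_n -> {poly k}, (exists i, (q i)`_0 != 0)
    & \sum_i ev x (q i) * v i = 0.
Proof.
move=> [i]; move: {2}(size (p i)) (leqnn (size (p i))) => s.
elim: s p => [|s IHs] p; first by rewrite leqn0 size_poly_eq0 => ->.
move=> ps pi0 pv; have [nz|z] := pselect (exists j, (p j)`_0 != 0).
  by exists p.
have pX j : p j = drop_poly 1 (p j) * 'X.
  rewrite {1}(poly_takeX0 (p j)) (_ : (p j)`_0 = 0) ?polyC0 ?add0r //.
  by apply/eqP/negPn/negP => pj; apply: z; exists j.
apply: (IHs (fun j => drop_poly 1 (p j))).
- by rewrite size_drop_poly; lia.
- by apply: contraNneq pi0 => di; rewrite (pX i) di mul0r.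
apply: (mulfI x0); rewrite mulr0 mulr_sumr -[RHS]pv; apply: eq_bigr => j _.
by rewrite [in RHS]pX rmorphM /= horner_morphX mulrCA mulrA.
Qed.


(* Dividing a relation over [k[x]] by a power of [x] makes its value at [x = 0]
   nontrivial. *)
Let dependent_L n d (v : 'I_n -> K) : (forall i, L d.+1 (v i)) ->
  (exists2 p : 'I_n -> {poly k}, (exists i, p i != 0)
     & \sum_i ev x (p i) * v i = 0) ->
  exists2 c : 'I_n -> k, (exists i, c i != 0)
    & exists2 u, L d u & \sum_i iota (c i) * v i = x * u.
Proof.
move=> Lv [p /strip_X h /h [q q0 qv]]; exists (fun i => (q i)`_0) => //.
pose u := \sum_i ev x (- drop_poly 1 (q i)) * v i.
have e : \sum_i iota (q i)`_0 * v i = x * u.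
  apply/eqP; rewrite -subr_eq0 mulr_sumr -sumrB -[X in _ == X]qv; apply/eqP.
  apply: eq_bigr => i _.
  rewrite [in RHS](poly_takeX0 (q i)) rmorphD rmorphM rmorphN /=.
  by rewrite horner_morphC horner_morphX; ring.
exists u => //; split.
  by apply: V_sum => i; apply: VM; [exact: VA|have [] := Lv i].
(* The polynomial coefficients of [u] have no bounded degree, but by [e] the product [x * u] is a
   combination of the [v i] over k, so its pole is no worse than theirs. *)
rewrite [u * x]mulrC -e.
rewrite mulr_suml; apply: integral_sum => i _; rewrite -mulrA.
apply: integral_mul; first exact: integral_ev_const.
by have [_] := Lv i; rewrite exprS invfM -mulrA mulVKf.
Qed.

(** By [dependent_L], [L d.+1] is spanned modulo [x L d] by [n] elements, so each step adds [n]
    generators to the old ones multiplied by [x]. *)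
Let L_finite n d :
  (forall v : 'I_n.+1 -> K, (forall i, total_fractions A (v i)) ->
     exists2 p : 'I_n.+1 -> {poly k}, (exists i, p i != 0)
       & \sum_i ev x (p i) * v i = 0) ->
  exists2 I : finType, #|I| = (n * d)%N
    & exists b : I -> K, L d `<=` lincomb iota b.
Proof.
move=> dep; elim: d => [|d [I cI [b hb]]].
  exists void; first by rewrite card_void muln0.
  by exists (fun=> 0) => z /L0_eq0 ->; exact: lincomb0.
have [|||v Lv|b' _ hb'] := @span_mod_of_dependent _ _ iota n (L d.+1)
    [set w | exists2 u, L d u & w = x * u].
- by split; [exact: VA|rewrite !mul0r; exact: integral0].
- exists 0; last by rewrite mulr0.
  by split; [exact: VA|rewrite !mul0r; exact: integral0].
- move=> c _ [u [Vu iu] ->]; exists (iota c * u); last by rewrite mulrCA.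
  split; first by apply: VM => //; exact: VA.
  by rewrite -!mulrA; apply: integral_mul; [exact: integral_ev_const|rewrite mulrA].
- by apply: dependent_L => //; apply: dep => i; have [[]] := Lv i.
exists ('I_n + I)%type; first by rewrite card_sum card_ord cI mulnS.
exists (fun s => match s with inl i => b' i | inr j => x * b j end).
move=> z /hb' [p [u /hb [c ->] /eqP]]; rewrite subr_eq => /eqP ->.
exists (fun s => match s with inl i => p i | inr j => c j end).
rewrite big_sumType /= addrC mulr_sumr; congr (_ + _).
by apply: eq_bigr => j _; rewrite mulrCA.
Qed.

(* [L d] has dimension at most [n d], while the multiples of the [e i] in it
   already span a subspace of dimension at least [n (d - m)]. *)
Let dependent_mod n m (e : 'I_n -> K) :
  (forall i, A (e i)) -> independent e -> (forall i, L m (e i)) ->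
  (forall v : 'I_n.+1 -> K, (forall i, total_fractions A (v i)) ->
     exists2 p : 'I_n.+1 -> {poly k}, (exists i, p i != 0)
       & \sum_i ev x (p i) * v i = 0) ->
  forall w : 'I_(n * m).+1 -> K, (forall i, V (w i)) ->
    exists2 p : 'I_(n * m).+1 -> k, (exists i, p i != 0)
      & lincomb (ev x) e (\sum_i iota (p i) * w i).
Proof.
move=> Ae ie Le dep w Vw; have [d0 Lw] := V_L_fin Vw.
pose t := d0; have [I cI [b Lb]] := L_finite (m + t) dep.
(* These are [n t + n m + 1] vectors, one more than the [n (m + t)] that span [L (m + t)]; [t] is
   large enough for this space to contain every [w l]. *)
pose v (s : 'I_n * 'I_t + 'I_(n * m).+1) :=
  match s with inl ij => x ^+ ij.2 * e ij.1 | inr l => w l end.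
have vb s : lincomb iota b (v s).
  apply: Lb; case: s => [[i j]|l] /=; last by apply: L_le (Lw l); rewrite leq_addl.
  apply: (@L_le (m + j)); first by rewrite leq_add2l ltnW.
  split.
    apply: VM; apply: VA => //.
    by rewrite -(horner_morphX (commr_field iota x)) -rmorphXn; exact: A_ev.
  have [_] := Le i; rewrite exprD; congr (Inty _).
  have := expf_neq0 m x0; have := expf_neq0 j x0.
  by move: (x ^+ m) (x ^+ j) => xm xj xj0 xm0; field; rewrite xj0 xm0.
have [|p [s0 ps0] pv] := @dependent_span _ _ iota _ I b v _ vb.
  by rewrite cI card_sum card_prod !card_ord; lia.
pose P i := \poly_(j < t) oapp (fun j => p (inl (i, j))) 0 (insub j).
have pw : \sum_l iota (p (inr l)) * w l = - \sum_i ev x (P i) * e i.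
  move: pv; rewrite big_sumType /= addrC => /eqP; rewrite addr_eq0 => /eqP ->.
  congr (- _).
  transitivity (\sum_s iota (p (inl (s.1, s.2))) * (x ^+ s.2 * e s.1)).
    by apply: eq_bigr => -[].
  rewrite -(pair_bigA _ (fun i j => iota (p (inl (i, j))) * (x ^+ j * e i))) /=.
  apply: eq_bigr => i _; rewrite ev_poly mulr_suml; apply: eq_bigr => j _.
  by rewrite valK /= mulrA.
exists (fun l => p (inr l)); last first.
  rewrite pw; exists (fun i => - P i).
  by rewrite -sumrN; apply: eq_bigr => i _; rewrite rmorphN mulNr.
(* Were the [w l] absent from the relation, it would relate the [x^j e i] alone, against the
   independence of [e]. *)
apply/not_existsP => p0.
have pr0 l : p (inr l) = 0 by apply/eqP/negPn/negP; exact: p0.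
have P0 : forall i, P i = 0.
  apply: ie; apply/eqP; rewrite -oppr_eq0 -pw big1 // => l _.
  by rewrite pr0 rmorph0 mul0r.
case: s0 ps0 => [[i j]|l]; last by rewrite pr0 eqxx.
have := congr1 (fun q : {poly k} => q`_j) (P0 i).
by rewrite coef_poly ltn_ord valK coef0 /= => ->; rewrite eqxx.
Qed.

(** Modulo the free module [M], [V] is spanned over k by finitely many [b i]. The products of [b i]
    with powers of [x] are dependent modulo [M], so a nonzero polynomial in [x] sends [b i] into
    [M]; the product of these polynomials sends all of [V] into [A]. *)
Lemma finite_normalization : exists2 c : {poly k}, c != 0 &
  forall z, normalization A z -> A ((map_poly iota c).[x] * z).
Proof.
have [n [[e Ae ie] dep]] := rank_exists.
have [m Le] := V_L_fin (fun i => VA (Ae i)).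
have depw := dependent_mod Ae ie Le dep.
pose M := lincomb (ev x) e.
have MZ p u : M u -> M (ev x p * u) by exact: lincombZ.
have MA u : M u -> A u.
  by move=> [c ->]; apply: A_sum => i; apply: AM => //; exact: A_ev.
have [||||b Vb hb] := @span_mod_of_dependent _ _ iota (n * m) V M.
- exact: VA.
- exact: lincomb0.
- by move=> c u; rewrite -(horner_morphC (commr_field iota x)); exact: MZ.
- exact: depw.
have /choice [c hc] : forall i, exists c : {poly k}, c != 0 /\ M (ev x c * b i).
  move=> i; have [|p p0 Mp] := depw (fun j => x ^+ j * b i).
    move=> j; apply: VM => //; apply: VA.
    by rewrite -(horner_morphX (commr_field iota x)) -rmorphXn; exact: A_ev.
  have [P P0 hP] := relation_poly iota p0; exists P; split=> //.
  by rewrite hP mulr_suml; under eq_bigr do rewrite -mulrA.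
pose C := \prod_i c i.
exists C => [|z /normalization_V /hb [p Mp]].
  by apply/prodf_neq0 => i _; have [] := hc i.
apply: MA; rewrite -[z](subrK (\sum_i iota (p i) * b i)) mulrDr.
apply: lincombD; first exact: MZ.
rewrite mulr_sumr; apply: lincomb_sum => i _.
rewrite -(horner_morphC (commr_field iota x)) mulrCA; apply: (MZ).
rewrite -[(map_poly iota C).[x]]/(ev x C) /C (bigD1 i) //= rmorphM /= mulrAC mulrC.
by apply: MZ; have [] := hc i.
Qed.

End FiniteNormalization.

(** * Noetherianity of polynomial rings *)

Section Ideals.
Variables (R : comNzRingType) (J : set R).
Hypothesis idJ : is_ideal setT J.

Lemma ideal_zero : J 0. Proof. by have [] := idJ. Qed.

Lemma ideal_add u v : J u -> J v -> J (u + v).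
Proof. by have [_ _ h _] := idJ; exact: h. Qed.

Lemma ideal_mull u v : J v -> J (u * v).
Proof. by have [_ _ _ h] := idJ; exact: h. Qed.

Lemma ideal_mulr u v : J u -> J (u * v).
Proof. by rewrite mulrC; exact: ideal_mull. Qed.

Lemma ideal_opp u : J u -> J (- u).
Proof. by rewrite -mulN1r; exact: ideal_mull. Qed.

Lemma ideal_sub u v : J u -> J v -> J (u - v).
Proof. by move=> Ju /ideal_opp; exact: ideal_add. Qed.

Lemma ideal_sum (T : Type) (s : seq T) (P : pred T) (F : T -> R) :
  (forall i, P i -> J (F i)) -> J (\sum_(i <- s | P i) F i).
Proof. by move=> h; apply: big_ind => //; [exact: ideal_zero|exact: ideal_add]. Qed.

End Ideals.

Lemma mono_subseq (u : nat -> nat) : exists g : nat -> nat,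
  (forall i, i <= g i)%N /\ forall i j, (i <= j)%N -> (u (g i) <= u j)%N.
Proof.
have /choice [g hg] : forall i, exists m, (i <= m)%N /\
    forall j, (i <= j)%N -> (u m <= u j)%N.
  move=> i; pose P v := `[< exists2 m, (i <= m)%N & u m = v >].
  have exP : exists v, P v by exists (u i); apply/asboolP; exists i.
  have [v /asboolP [m im <-] min] := ex_minnP exP.
  by exists m; split=> // j ij; apply: min; apply/asboolP; exists j.
exists g; split=> [i|i j ij]; have [gi h] := hg i => //.
exact: h.
Qed.

(** A subsequence good for [us] is thinned for [u]: each new index is a place where [u] is least
    among all indices after the previous one. *)
Lemma mono_subseqs (us : seq (nat -> nat)) : exists phi : nat -> nat,
  {homo phi : i j / (i < j)%N} /\
  forall i j, (i <= j)%N -> all (fun u => u (phi i) <= u (phi j))%N us.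
Proof.
elim: us => [|u us [phi [phi_lt hphi]]]; first by exists id; split.
have [g [gi gm]] := mono_subseq (u \o phi).
pose psi := fix psi i := if i is i'.+1 then g (psi i').+1 else g 0%N.
have psi_lt : {homo psi : i j / (i < j)%N}.
  by apply: homo_ltn => [? ? ?|i]; [exact: ltn_trans|exact: gi].
have psi_min i j : (i <= j)%N -> (u (phi (psi i)) <= u (phi (psi j)))%N.
  rewrite leq_eqVlt => /predU1P [-> //|/psi_lt ij].
  case: i ij => [|i] ij; apply: gm => //.
  by apply: leq_trans (gi _) _; exact: ltnW.
exists (phi \o psi); split=> [i j ij|i j ij] /=; first exact/phi_lt/psi_lt.
rewrite psi_min //=; apply: hphi.
by move: ij; rewrite leq_eqVlt => /predU1P [-> //|/psi_lt /ltnW].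
Qed.

(** Otherwise an infinite sequence can be picked in [E] with no term above an earlier one; a
    subsequence nondecreasing in every coordinate contradicts this. *)
Lemma dickson n (E : set 'X_{1..n}) : exists s : seq 'X_{1..n},
  (forall m, m \in s -> E m) /\
  forall m, E m -> exists2 m', m' \in s & (m' <= m)%MM.
Proof.
apply: contrapT => nos.
have /choice [pick hpick] : forall s : seq 'X_{1..n}, exists m,
    (forall m', m' \in s -> E m') ->
    E m /\ forall m', m' \in s -> ~ (m' <= m)%MM.
  move=> s; have [sE|nsE] := pselect (forall m', m' \in s -> E m'); last first.
    by exists 0%MM => /nsE.
  have : ~ forall m, E m -> exists2 m', m' \in s & (m' <= m)%MM.
    by move=> h; apply: nos; exists s.
  move=> /existsNP [m /not_implyP [Em h]]; exists m => _; split=> // m' m's m'm.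
  by apply: h; exists m'.
pose S := fix S i := if i is i'.+1 then rcons (S i') (pick (S i')) else [::].
have SE i : forall m, m \in S i -> E m.
  elim: i => [|i IHi] m //=; rewrite mem_rcons inE => /predU1P [->|/IHi //].
  by have [] := hpick _ IHi.
have S_mem i j : (i < j)%N -> pick (S i) \in S j.
  elim: j => // j IHj; rewrite ltnS leq_eqVlt /= mem_rcons inE.
  move=> /predU1P [->|/IHj ->].
    by rewrite eqxx.
  by rewrite orbT.
have [phi [phi_lt hphi]] :=
  mono_subseqs [seq (fun t => pick (S t) i) | i : 'I_n].
have [_ /(_ (pick (S (phi 0%N))))] := hpick _ (SE (phi 1%N)).
apply; first exact/S_mem/phi_lt.
apply/mnm_lepP => i; have := hphi 0%N 1%N isT.
by rewrite all_map => /allP /(_ i (mem_enum _ _)).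
Qed.

(** By [dickson], finitely many elements [F m] of the ideal [G] generated by [X] have leading
    monomials dividing those of all nonzero elements of [G]. Each [F m] comes from finitely many
    elements of [X], which allows the generators to be chosen in [X] itself. *)
Lemma mpoly_noetherian (k : fieldType) n (X : set {mpoly k[n]}) :
  exists s : seq {mpoly k[n]}, (forall f, f \in s -> X f) /\
    forall J, is_ideal setT J -> (forall f, f \in s -> J f) -> X `<=` J.
Proof.
pose gen (s : seq {mpoly k[n]}) : set {mpoly k[n]} :=
  [set f | forall J, is_ideal setT J -> (forall g, g \in s -> J g) -> J f].
pose G : set {mpoly k[n]} :=
  [set f | exists2 s, (forall g, g \in s -> X g) & gen s f].
have XG f : X f -> G f.
  by move=> Xf; exists [:: f] => [g|J _]; [rewrite inE => /eqP ->|apply; rewrite inE].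
have idG : is_ideal setT G.
  split=> //.
  - by exists [::] => // J idJ _; exact: ideal_zero.
  - move=> f g [s sX sf] [t tX tg]; exists (s ++ t).
      by move=> h; rewrite mem_cat => /orP [/sX|/tX].
    move=> J idJ stJ; apply: ideal_add => //.
      by apply: sf => // h hs; apply: stJ; rewrite mem_cat hs.
    by apply: tg => // h ht; apply: stJ; rewrite mem_cat ht orbT.
  - by move=> a f _ [s sX sf]; exists s => // J idJ sJ;
      apply: ideal_mull => //; exact: sf.
have [ms [msE hms]] := dickson [set m | exists2 f, G f & f != 0 /\ mlead f = m].
have /choice [F hF] : forall m, exists f, m \in ms ->
    [/\ G f, f != 0 & mlead f = m].
  move=> m; have [/msE [f Gf [f0 fm]]|_] := boolP (m \in ms); last by exists 0.
  by exists f.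
have /choice [s hs] : forall m, exists s, m \in ms ->
    (forall g, g \in s -> X g) /\ gen s (F m).
  move=> m; have [mms|_] := boolP (m \in ms); last by exists [::].
  by have [[s sX sF] _ _] := hF _ mms; exists s.
exists (flatten [seq s m | m <- ms]); split=> [f /flatten_mapP [m mms fs]|J idJ sJ].
  by have [sX _] := hs _ mms; exact: sX.
have FJ m : m \in ms -> J (F m).
  move=> mms; have [_] := hs _ mms; apply=> // g gs.
  by apply: sJ; apply/flatten_mapP; exists m.
suff GJ f : G f -> J f by move=> f /XG /GJ.
have [->|f0] := eqVneq f 0; first by move=> _; exact: ideal_zero.
elim/(well_founded_induction (@ltom_wf n)): {f}(mlead f) {-2}f f0 (erefl (mlead f)).
move=> m IHm f f0 fm Gf.
have [m' m'ms m'm] := hms m (ex_intro2 _ _ f Gf (conj f0 (esym fm))).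
have [GF F0 Fm'] := hF _ m'ms.
(* One division step: [g] is zero or has a smaller leading monomial than [f]. *)
pose c := mleadc f / mleadc (F m').
pose g := f - (c *: 'X_[m - m']) * F m'.
have Gg : G g by apply: ideal_sub => //; exact: ideal_mull.
suff Jg : J g.
  rewrite -[f](subrK (c *: 'X_[m - m'] * F m')); apply: ideal_add => //.
  by apply: ideal_mull => //; exact: FJ.
have [->|g0] := eqVneq g 0; first exact: ideal_zero.
apply: (IHm (mlead g) _ g g0 erefl Gg).
rewrite lt_neqAle; apply/andP; split; last first.
  apply: le_trans (mleadB_le _ _) _; rewrite -fm leUx lexx /= -scalerAl.
  apply: le_trans (mleadZ_le _ _) _; apply: le_trans (mleadM_le _ _) _.
  by rewrite mleadXm Fm' submK.
apply: contra_neq g0 => gm; apply/eqP; rewrite -mleadc_eq0 gm /g mcoeffB.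
have -> : (c *: 'X_[m - m'] * F m')@_m = c * mleadc (F m').
  rewrite -scalerAl mcoeffZ [_ * F _]mulrC -[X in (_ * _)@_X](submK m'm) mcoeffMX.
  by rewrite Fm'.
by rewrite /c divfK ?mleadc_eq0 // fm subrr.
Qed.

(** * Homogeneous ideals *)

Section Homogeneous.
Variables (k : fieldType) (r : nat).
Local Notation S := {mpoly k[r.+1]}.
Local Notation part := (pihomog mdeg).

Lemma homog_sum (f : S) : f = \sum_(d < msize f) part d f.
Proof. exact: pihomog_partitionE. Qed.

Lemma pihomog_homog d e (f : S) : f \is d.-homog ->
  part e f = if d == e then f else 0.
Proof.
by move=> hf; case: eqP => [<-|/eqP de]; [exact: pihomog_dE|exact: pihomog_ne0 hf].
Qed.

Lemma pihomog_msize d (f : S) : (msize f <= d)%N -> part d f = 0.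
Proof.
move=> fd; rewrite pihomogE big_seq_cond big_pred0 // => m.
apply/negP => /andP [/msize_mdeg_lt mf /eqP md].
by have := leq_trans mf fd; rewrite -md ltnn.
Qed.

Lemma pihomogM d n (f g : S) : f \is d.-homog ->
  part n (f * g) = if (d <= n)%N then f * part (n - d) g else 0.
Proof.
move=> hf; rewrite [in LHS](homog_sum g) mulr_sumr raddf_sum /=.
rewrite (eq_bigr (fun i : 'I_(msize g) =>
  if (i + d)%N == n then f * part i g else 0)); last first.
  move=> i _; rewrite (@pihomog_homog (d + i)) 1?[(i + d)%N]addnC //.
  by apply: dhomogM => //; exact: pihomogP.
case: leqP => dn; last first.
  by rewrite big1 // => i _; case: eqP => // e; lia.
rewrite -big_mkcond /=.
have [ng|ng] := ltnP (n - d) (msize g).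
  rewrite (big_pred1 (Ordinal ng)) // => i; rewrite /= -val_eqE /=.
  by apply/eqP/eqP; lia.
rewrite big_pred0 => [|i]; last by apply/eqP; have := ltn_ord i; lia.
by rewrite pihomog_msize ?mulr0.
Qed.

Lemma pihomogM_sum n (f g : S) :
  part n (f * g) = \sum_(i < msize f | (i <= n)%N) part i f * part (n - i) g.
Proof.
rewrite [in LHS](homog_sum f) mulr_suml raddf_sum [RHS]big_mkcond.
by apply: eq_bigr => i _; apply: pihomogM; exact: pihomogP.
Qed.

Section Ideals.
Variable J : set S.
Hypothesis idJ : is_ideal setT J.

Lemma ideal_part f : (forall d, J (part d f)) -> J f.
Proof. by move=> h; rewrite (homog_sum f); apply: ideal_sum. Qed.

Lemma ideal_nmem_part f : ~ J f -> exists d, ~ J (part d f).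
Proof. by move=> nf; apply/existsNP => h; exact/nf/ideal_part. Qed.

End Ideals.

(** For [f] and [g] outside [J], take their components of highest degrees [d] and [e] outside [J]:
    every other contribution to the component of [f * g] in degree [d + e] lies in [J]. *)
Lemma homogeneous_prime (J : set S) : homogeneous_ideal J -> ~ J 1 ->
  (forall d e f g, f \is d.-homog -> g \is e.-homog -> J (f * g) -> J f \/ J g) ->
  is_prime setT J.
Proof.
move=> [idJ homJ] J1 prJ; split=> // f g _ _ Jfg.
have top h : ~ J h -> exists2 d, ~ J (part d h) & forall e, (d < e)%N -> J (part e h).
  move=> Jh; pose P d := `[< ~ J (part d h) >].
  have exP : exists d, P d.
    by have [d hd] := ideal_nmem_part idJ Jh; exists d; apply/asboolP.
  have bP d : P d -> (d <= msize h)%N.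
    move=> /asboolP; apply: contra_notT; rewrite -ltnNge => hd.
    by rewrite pihomog_msize ?(ltnW hd) //; exact: ideal_zero.
  have [d /asboolP Pd maxd] := ex_maxnP exP bP; exists d => // e de.
  by apply: contrapT => Je; have := maxd e (asboolT Je); rewrite leqNgt de.
apply: contrapT => /not_orP [/top [d Jd dmax] /top [e Je emax]].
suff : J (part d f) \/ J (part e g) by case.
apply: (prJ d e); try exact: pihomogP.
have := homJ (f * g) (d + e)%N Jfg; rewrite pihomogM_sum.
have df : (d < msize f)%N.
  rewrite ltnNge; apply: contra_notN Jd => hd.
  by rewrite pihomog_msize //; exact: ideal_zero.
rewrite (bigD1 (Ordinal df)) ?leq_addr //= addKn => Jsum.
rewrite -[_ * _](addrK (\sum_(i < msize f | (i <= d + e)%N && (i != Ordinal df))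
  part i f * part (d + e - i) g)).
apply: ideal_sub => //; apply: ideal_sum => // i /andP [ide].
rewrite -val_eqE /= neq_ltn => /orP [id|di].
  by apply: ideal_mull => //; apply: emax; lia.
by apply: ideal_mulr => //; exact: dmax.
Qed.

Definition adjoin (J : set S) (c : S) : set S :=
  [set f | exists2 u, J u & exists a, f = u + a * c].

Lemma adjoin_sub J c : J `<=` adjoin J c.
Proof. by move=> f Jf; exists f => //; exists 0; rewrite mul0r addr0. Qed.

Lemma adjoin_id J c : J 0 -> adjoin J c c.
Proof. by move=> J0; exists 0 => //; exists 1; rewrite mul1r add0r. Qed.

Lemma adjoin_ideal J c : is_ideal setT J -> is_ideal setT (adjoin J c).
Proof.
move=> idJ; split=> //.
- by apply: adjoin_sub; exact: ideal_zero.
- move=> _ _ [u Ju [a ->]] [v Jv [b ->]]; exists (u + v); first exact: ideal_add.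
  by exists (a + b); ring.
- move=> b _ _ [u Ju [a ->]]; exists (b * u); first exact: ideal_mull.
  by exists (b * a); ring.
Qed.

Lemma adjoin_homogeneous J d c : c \is d.-homog ->
  homogeneous_ideal J -> homogeneous_ideal (adjoin J c).
Proof.
move=> hc [idJ homJ]; split; first exact: adjoin_ideal.
move=> _ e [u Ju [a ->]]; exists (part e u); first exact: homJ.
rewrite raddfD /= mulrC (pihomogM _ _ hc); case: leqP => _.
  by exists (part (e - d) a); rewrite [c * _]mulrC.
by exists 0; rewrite mul0r.
Qed.

(** The usual maximality argument applies because primality need only be tested on forms, and
    adjoining a form keeps an ideal homogeneous. *)
Lemma homogeneous_prime_avoiding (J T : set S) :
  homogeneous_ideal J -> T 1 -> (forall f g, T f -> T g -> T (f * g)) ->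
  (forall f, J f -> ~ T f) ->
  exists P, [/\ homogeneous_ideal P, is_prime setT P, J `<=` P
    & forall f, P f -> ~ T f].
Proof.
move=> homJ T1 TM JT.
pose good (P : set S) :=
  [/\ homogeneous_ideal P, J `<=` P & forall f, P f -> ~ T f].
have goodJ : good J by split.
have [F FP totF|P [[P0|[homP JP PT]] maxP]] :=
    @Zorn_bigcup S [set P | P = set0 \/ good P].
- have [F0|] := pselect (forall X, F X -> X = set0).
    by left; rewrite -subset0 => f [X /F0 ->].
  move=> /existsNP [X0 /not_implyP [FX0 X0n]]; right.
  have goodX X f : F X -> X f -> good X.
    by move=> /FP [->|//].
  have goodX0 : good X0 by have [] := FP _ FX0.
  split.
  + split; last first.
      move=> f d [X FX Xf]; exists X => //.
      by have [[_ homX] _ _] := goodX _ _ FX Xf; exact: homX.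
    split=> //.
    * exists X0 => //; have [[idX _] _ _] := goodX0; exact: ideal_zero.
    * move=> f g [X FX Xf] [Y FY Yg].
      have [[idX _] _ _] := goodX _ _ FX Xf.
      have [[idY _] _ _] := goodX _ _ FY Yg.
      have [XY|YX] := totF _ _ FX FY.
        by exists Y => //; apply: ideal_add => //; exact: XY.
      by exists X => //; apply: ideal_add => //; exact: YX.
    * move=> a f _ [X FX Xf]; have [[idX _] _ _] := goodX _ _ FX Xf.
      by exists X => //; exact: ideal_mull.
  + by move=> f Jf; exists X0 => //; have [_ + _] := goodX0; exact.
  + by move=> f [X FX Xf]; have [_ _ +] := goodX _ _ FX Xf; exact.
- exfalso; apply: (maxP J); last by right.
  by rewrite P0; split=> // /(_ _ (ideal_zero homJ.1)).
- exists P; split=> //; apply: homogeneous_prime => //.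
    by move=> /PT; exact.
  move=> d e f g hf hg Pfg; apply: contrapT => /not_orP [Pf Pg].
  have [idP _] := homP.
  have meets d' h : h \is d'.-homog -> ~ P h ->
      exists2 u, P u & exists a, T (u + a * h).
    move=> hh Ph; apply: contrapT => nT; apply: (maxP (adjoin P h)).
      split; last by move=> /(_ _ (adjoin_id _ (ideal_zero idP))).
      exact: adjoin_sub.
    right; split; first exact: adjoin_homogeneous hh homP.
      by move=> x /JP; exact: adjoin_sub.
    by move=> x [u Pu [a ->]] Tx; apply: nT; exists u => //; exists a.
  have [u Pu [a Tf]] := meets _ _ hf Pf.
  have [v Pv [b Tg]] := meets _ _ hg Pg.
  apply: (PT _ _ (TM _ _ Tf Tg)).
  have -> : (u + a * f) * (v + b * g) =
      u * (v + b * g) + (a * f * v + a * b * (f * g)) by ring.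
  apply: ideal_add => //; first exact: ideal_mulr.
  by apply: ideal_add => //; exact: ideal_mull.
Qed.


End Homogeneous.

(** * Points of the curve *)

Section Points.
Variables (k : fieldType) (r : nat) (I : prime_idealr {mpoly k[r.+1]}).
Local Notation S := {mpoly k[r.+1]}.
Local Notation part := (pihomog mdeg).

Section OnePoint.
Variable P : set S.
Hypothesis ptP : proj_points I P.

Lemma point_homogeneous : homogeneous_ideal P.
Proof. by have [] := ptP. Qed.

Lemma point_ideal : is_ideal setT P.
Proof. by have [] := point_homogeneous. Qed.

Lemma point_nonunit : ~ P 1.
Proof. by have [_ []] := ptP. Qed.

Lemma point_mul f g : ~ P f -> ~ P g -> ~ P (f * g).
Proof. by have [_ [_ _ h] _ _] := ptP; move=> Pf Pg /h [||/Pf|/Pg]. Qed.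

Lemma point_exp f n : ~ P f -> ~ P (f ^+ n).
Proof.
move=> Pf; elim: n => [|n IHn]; first exact: point_nonunit.
by rewrite exprS; exact: point_mul.
Qed.

Lemma point_curve f : f \in I -> P f.
Proof. by have [_ _ h _] := ptP; exact: h. Qed.

Lemma point_notin f : ~ P f -> f \notin I.
Proof. by move=> Pf; apply/negP => /point_curve. Qed.

Lemma point_form d : exists2 f : S, f \is d.-homog & ~ P f.
Proof.
have [_ _ _ [i Xi]] := ptP; exists ('X_i ^+ d); last exact: point_exp.
have := @dhomogMn _ k mdeg 1 'X_i d; rewrite mul1n; apply.
by rewrite dhomogX; apply/eqP; exact: mdeg1.
Qed.

End OnePoint.

Hypothesis curve : integral_curve I.
Local Notation Iset := ([set f | f \in I] : set S).

Lemma curve_point : proj_points I Iset.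
Proof. by have [] := curve. Qed.

(** Otherwise the curve, [P] and [Q] would form a chain of length two, which dimension one
    forbids. *)
Lemma point_chain P Q : proj_points I P -> proj_points I Q ->
  (exists2 f, P f & f \notin I) -> P `<=` Q -> P = Q.
Proof.
move=> ptP ptQ [f Pf fI] PQ; apply: contrapT => PnQ.
have [_ [_]] := curve; apply.
exists (fun i => match i with 0 => Iset | 1 => P | _ => Q end); split.
  by case=> [|[|[|//]]] _ //; exact: curve_point.
case=> [|[|//]] _.
  split; first by move=> g; exact: point_curve.
  by move=> /(_ f Pf) /=; exact/negP.
by split=> // QP; apply: PnQ; exact/seteqP.
Qed.

(* Localizing at [P]: no prime lies strictly between the curve and [P], so some
   power of each [p] in [P] is a multiple of [c] up to a denominator prime to
   [P]. *)
Lemma power_in_adjoin c d P p e : c \is d.-homog -> c \notin I ->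
  proj_points I P -> p \is e.-homog -> P p ->
  exists n m t, [/\ t \is m.-homog, ~ P t & adjoin Iset c (t * p ^+ n)].
Proof.
move=> hc cI ptP hp Pp; apply: contrapT => no.
(* A homogeneous prime containing [c] and avoiding [T] lies in [P], by the elements with [n = 0],
   and is larger than [Iset]; so it is [P], which contains the element [p] of [T]. *)
pose T : set S := [set f | exists n m t,
  [/\ t \is m.-homog, ~ P t & f = t * p ^+ n]].
have [||||Q [homQ prQ cQ QT]] :=
    @homogeneous_prime_avoiding _ _ (adjoin Iset c) T.
- by apply: adjoin_homogeneous hc _; exact: point_homogeneous curve_point.
- exists 0, 0, 1; split; [exact: dhomog1|exact: point_nonunit ptP|].
  by rewrite mulr1.
- move=> _ _ [n [m [t [ht Pt ->]]]] [n' [m' [t' [ht' Pt' ->]]]].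
  exists (n + n')%N, (m + m')%N, (t * t'); split.
  + exact: dhomogM.
  + exact: (point_mul ptP).
  + by rewrite exprD mulrACA.
- by move=> f Jf [n [m [t [ht Pt e']]]]; apply: no; exists n, m, t; rewrite -e'.
have QP : Q `<=` P.
  move=> f Qf; apply: contrapT => Pf.
  have [d' Pd] := ideal_nmem_part (point_ideal ptP) Pf.
  apply: (QT (part d' f)); first by have [_] := homQ; apply.
  by exists 0, d', (part d' f); rewrite mulr1; split=> //; exact: pihomogP.
have ptQ : proj_points I Q.
  have [_ _ _ [i Xi]] := ptP; split=> //; last by exists i => /QP.
  by move=> f If; apply/cQ/adjoin_sub.
have PQ : Q = P.
  apply: point_chain => //; exists c => //; apply: cQ.
  exact/adjoin_id/(ideal_zero (point_ideal curve_point)).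
apply: (QT p); first by rewrite PQ.
exists 1%N, 0, 1; split; [exact: dhomog1|exact: point_nonunit ptP|].
by rewrite mul1r.
Qed.

(** Finitely many forms generate [P], and the product of the forms that [power_in_adjoin] yields for
    each of them serves for all. An ideal not containing [P] misses one of the generators. *)
Lemma separating_form c d P : c \is d.-homog -> c \notin I -> proj_points I P ->
  exists e t, [/\ t \is e.-homog, ~ P t
    & forall Q, is_ideal setT Q -> ~ P `<=` Q ->
      exists e' p n, [/\ p \is e'.-homog, P p, ~ Q p & adjoin Iset c (t * p ^+ n)]].
Proof.
move=> hc cI ptP.
have [s [sP hs]] := mpoly_noetherian [set f | P f /\ exists e, f \is e.-homog].
have idJ := adjoin_ideal c (point_ideal curve_point).
suff [e [t [ht Pt hst]]] : exists e t, [/\ t \is e.-homog, ~ P t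
    & forall p, p \in s -> exists n, adjoin Iset c (t * p ^+ n)].
  exists e, t; split=> // Q idQ PQ.
  have [p ps Qp] : exists2 p, p \in s & ~ Q p.
    apply: contrapT => no; apply: PQ => f Pf; apply: (ideal_part idQ) => d'.
    apply: (hs Q idQ) => [g gs|]; first by apply: contrapT => Qg; apply: no; exists g.
    split; first by have [_] := point_homogeneous ptP; apply.
    by exists d'; exact: pihomogP.
  by have [Pp [e' hp]] := sP _ ps; have [n hn] := hst _ ps; exists e', p, n.
elim: s sP {hs} => [|p s IHs] sP.
  by exists 0, 1; split=> //; [exact: dhomog1|exact: point_nonunit ptP].
have [|e [t [ht Pt hst]]] := IHs.
  by move=> f fs; apply: sP; rewrite inE fs orbT.
have [Pp [e' hp]] := sP p (mem_head _ _).
have [n [m [t' [ht' Pt' h']]]] := power_in_adjoin hc cI ptP hp Pp.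
exists (m + e)%N, (t' * t); split; [exact: dhomogM|exact: (point_mul ptP)|].
move=> f; rewrite inE => /predU1P [->|/hst [n' hn']].
  by exists n; rewrite mulrAC; exact: ideal_mulr.
by exists n'; rewrite -mulrA; exact: ideal_mull.
Qed.

Lemma adjoin_mem c f (Q : set S) : is_ideal setT Q -> Iset `<=` Q -> Q c ->
  adjoin Iset c f -> Q f.
Proof.
move=> idQ IQ Qc [u Iu [a ->]]; apply: ideal_add => //; first exact: IQ.
exact: ideal_mull.
Qed.

(* By [separating_form], the points on the hypersurface [c = 0] are isolated
   from one another; by noetherianity finitely many of the separating forms have
   no common zero there. *)
Lemma avoiding_form d c : c \is d.-homog -> c \notin I ->
  exists e y, y \is e.+1.-homog /\
    forall Q, proj_points I Q -> Q c -> ~ Q y.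
Proof.
move=> hc cI.
pose X : set S := [set t | exists e, t \is e.+1.-homog /\
  exists Q, [/\ proj_points I Q, Q c
    & forall Q', proj_points I Q' -> Q' c -> Q' <> Q -> Q' t]].
have [s [sX hs]] := mpoly_noetherian X.
suff [e [y [hy hys]]] : exists e y, y \is e.+1.-homog /\
    forall Q, proj_points I Q -> Q c -> (exists2 t, t \in s & ~ Q t) -> ~ Q y.
  exists e, y; split=> // Q ptQ Qc; apply: hys => //.
  apply: contrapT => no; have [e' [t [ht Qt hsep]]] := separating_form hc cI ptQ.
  (* The factor [l] makes the degree positive, so that degrees can later be equalized by taking
     powers. *)
  have [l hl Ql] := point_form ptQ 1.
  apply: (point_mul ptQ Qt Ql); apply: (hs Q (point_ideal ptQ)).
    by move=> f fs; apply: contrapT => Qf; apply: no; exists f.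
  exists e'; split; first by have := dhomogM ht hl; rewrite addn1.
  exists Q; split=> // Q' ptQ' Q'c Q'Q.
  apply: (ideal_mulr (point_ideal ptQ')).
  have [|e'' [p [n [hp Qp Q'p h]]]] := hsep Q' (point_ideal ptQ').
    by move=> QQ'; apply/Q'Q/esym/point_chain => //; exists c.
  apply: contrapT => Q't; apply: (point_mul ptQ' Q't (point_exp (n := n) ptQ' Q'p)).
  apply: (adjoin_mem (point_ideal ptQ') _ Q'c h) => f.
  exact: point_curve.
elim: s sX {hs} => [|t s IHs] sX.
  have [l hl Il] := point_form curve_point 1.
  by exists 0%N, l; split=> // Q _ _ [].
have [|e [y [hy hys]]] := IHs; first by move=> f fs; apply: sX; rewrite inE fs orbT.
have [e' [ht [P [ptP Pc hP]]]] := sX t (mem_head _ _).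
have [Py|Py] := pselect (P y); last first.
  exists e, y; split=> // Q ptQ Qc [f]; rewrite inE => /predU1P [->|fs] Qf.
    by have [->//|QP] := pselect (Q = P); case: Qf; exact: hP.
  by apply: hys => //; exists f.
(* At [P] the form [y] vanishes and only [t] counts; at the other points of the hypersurface [t]
   vanishes and only [y] counts. *)
exists (e.+1 * e'.+1).-1, (y ^+ e'.+1 + t ^+ e.+1); split.
  rewrite prednK ?muln_gt0 //; apply: dhomogD; first exact: dhomogMn.
  by rewrite mulnC; exact: dhomogMn.
move=> Q ptQ Qc [f]; rewrite inE; have [->|QP] := pselect (Q = P).
  move=> fts Pf Pyt; have [Pt|Pt] := pselect (P t).
    move: fts Pf => /predU1P [->//|fs Pf].
    by apply: (hys P ptP Pc) => //; exists f.
  apply: (point_exp (n := e.+1) ptP Pt).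
  rewrite -[t ^+ _](addKr (y ^+ e'.+1)) addrC.
  apply: ideal_sub => //; first exact: point_ideal ptP.
  by rewrite exprS; apply: ideal_mulr => //; exact: point_ideal ptP.
have Qt : Q t by exact: hP.
move=> /predU1P [->//|fs] Qf Qyt.
apply: (point_exp (n := e'.+1) ptQ (hys Q ptQ Qc (ex_intro2 _ _ f fs Qf))).
rewrite -[y ^+ _](addrK (t ^+ e.+1)); apply: ideal_sub => //.
  exact: point_ideal ptQ.
by rewrite exprS; apply: ideal_mulr => //; exact: point_ideal ptQ.
Qed.

(** A chain of length one provides a form vanishing at a point but not on the curve, and
    [avoiding_form] its partner. Having no common zero, the two define a map from the curve to the
    projective line. *)
Lemma exists_parameters : exists e y0 y1,
  [/\ y0 \is e.+1.-homog, y1 \is e.+1.-homog,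
  y0 \notin I,
  (exists2 Q, proj_points I Q & Q y0)
  & forall Q, proj_points I Q -> Q y0 -> ~ Q y1].
Proof.
have [_ [[c [cpt clt]] _]] := curve.
have [ptc0 ptc1] : proj_points I (c 0%N) /\ proj_points I (c 1%N).
  by split; exact: cpt.
have [c01 /existsNP [f /not_implyP [cf ncf]]] := clt 0%N isT.
have [d fd] := ideal_nmem_part (point_ideal ptc0) ncf.
have cfd : c 1%N (part d f) by have [_] := point_homogeneous ptc1; apply.
have [l hl Il] := point_form curve_point 1.
pose y0 := part d f * l.
have hy0 : y0 \is d.+1.-homog.
  by have := dhomogM (pihomogP mdeg d f) hl; rewrite addn1.
have y0I : y0 \notin I.
  rewrite prime_idealrM negb_or; apply/andP; split; apply/negP => //.
  by move=> /(point_curve ptc0).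
have [e [y1 [hy1 y01]]] := avoiding_form hy0 y0I.
exists (d.+1 * e.+1).-1, (y0 ^+ e.+1), (y1 ^+ d.+1).
rewrite prednK ?muln_gt0 //; split; first exact: dhomogMn.
- by rewrite mulnC; exact: dhomogMn.
- exact/negP/(point_exp (n := e.+1) curve_point)/negP.
- exists (c 1%N) => //; rewrite exprS.
  by do 2![apply: ideal_mulr; first exact: point_ideal].
move=> Q ptQ Qy0; apply: (point_exp ptQ); apply: y01 => //.
by apply: contrapT => /(point_exp (n := e.+1) ptQ); apply.
Qed.

End Points.

(** * The conductor of a chart *)

(* For the canonical map [q] from the polynomials to the fractions of the
   coordinate ring, this is [local_ideal I P J].  Keeping the field abstract
   prevents unification from computing with classes of fractions. *)
Definition stalk_ideal (k : fieldType) (r : nat) (K : fieldType)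
    (q : {mpoly k[r.+1]} -> K) (P J : set {mpoly k[r.+1]}) : set K :=
  [set z | exists d f g,
     [/\ J f, f \is d.-homog, g \is d.-homog, ~ P g & z = q f / q g]].

Notation stalk q P := (stalk_ideal q P setT).

Section Chart.
Variables (k : fieldType) (r : nat) (I : prime_idealr {mpoly k[r.+1]}).
Local Notation S := {mpoly k[r.+1]}.
Variables (K : fieldType) (q : {rmorphism S -> K}).
Hypothesis q_eq0 : forall f, (q f == 0) = (f \in I).
Local Notation part := (pihomog mdeg).
Local Notation Iset := ([set f | f \in I] : set S).

Definition constants : k -> K := q \o @mpolyC r.+1 k.

HB.instance Definition _ := GRing.RMorphism.on constants.

Local Notation iota := constants.

Hypothesis curve : integral_curve I.
Variables (e : nat) (y0 y1 : S).
Hypothesis hy0 : y0 \is e.+1.-homog.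
Hypothesis hy1 : y1 \is e.+1.-homog.
Hypothesis y0I : y0 \notin I.
Hypothesis y01 : forall Q, proj_points I Q -> Q y0 -> ~ Q y1.

Let J := adjoin (adjoin Iset y0) y1.

Let idI : is_ideal setT Iset := point_ideal (curve_point curve).

Let homJ : homogeneous_ideal J.
Proof.
apply: adjoin_homogeneous hy1 _; apply: adjoin_homogeneous hy0 _.
exact/point_homogeneous/curve_point.
Qed.

Let q0 : q y0 != 0. Proof. by rewrite q_eq0. Qed.

Let q_neq0 (Q : set S) f : proj_points I Q -> ~ Q f -> q f != 0.
Proof. by move=> ptQ /(point_notin ptQ); rewrite q_eq0. Qed.

(** A case of the projective Nullstellensatz: a homogeneous prime containing [J] but no power of
    ['X_i] would be a common zero of [y0] and [y1]. *)
Lemma expn_in_parameters (i : 'I_r.+1) : exists n, J ('X_i ^+ n).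
Proof.
apply: contrapT => no.
have [|||P [homP prP JP PT]] := @homogeneous_prime_avoiding _ _ J
    [set f | exists n, f = 'X_i ^+ n] homJ.
- by exists 0%N.
- by move=> _ _ [n ->] [m ->]; exists (n + m)%N; rewrite exprD.
- by move=> f Jf [n fn]; apply: no; exists n; rewrite -fn.
have ptP : proj_points I P.
  split=> //; first by move=> f If; apply/JP/adjoin_sub/adjoin_sub.
  by exists i => /PT; apply; exists 1%N.
apply: (y01 ptP); apply: JP; last exact/adjoin_id/(ideal_zero (adjoin_ideal _ idI)).
exact/adjoin_sub/adjoin_id/(ideal_zero idI).
Qed.

Lemma high_degree_in_parameters : exists D, (0 < D)%N /\
  forall d f, (D <= d)%N -> f \is d.-homog -> J f.
Proof.
have [idJ _] := homJ.
have /choice [n hn] := expn_in_parameters.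
pose N := (\max_i n i)%N.
have JN i : J ('X_i ^+ N).
  rewrite -(subnK (leq_bigmax i : (n i <= N)%N)) exprD; exact: ideal_mull.
exists (r.+1 * N).+1; split=> // d f Dd hf.
rewrite (mpolyE f) big_seq; apply: ideal_sum => // m mf; rewrite -mul_mpolyC.
apply: ideal_mull => //.
have md : mdeg m = d := dhomog_mf hf mf.
have [i Ni] : exists i, (N <= m i)%N.
  apply: contrapT => /forallNP no; move: Dd; rewrite -md mdegE leqNgt ltnS.
  move/negP; apply; apply: (@leq_trans (\sum_(i < r.+1) N)%N).
    by apply: leq_sum => i _; rewrite leqNgt; apply/negP => /ltnW; exact: no.
  by rewrite sum_nat_const card_ord.
have -> : m = (m - U_(i) *+ N + U_(i) *+ N)%MM.
  rewrite submK //; apply/mnm_lepP => j; rewrite mulmnE mnm1E.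
  by case: eqP => [<-|_]; rewrite ?mul1n ?mul0n.
by rewrite mpolyXD -mpolyXn; exact: ideal_mull.
Qed.

(** The coordinate ring of the chart where [y0] does not vanish. *)
Let A : set K :=
  [set z | exists j f, f \is (e.+1 * j).-homog /\ z = q f / q y0 ^+ j].
Let x : K := q y1 / q y0.

Let AD u v : A u -> A v -> A (u + v).
Proof.
move=> [j [f [hf ->]]] [l [g [hg ->]]].
exists (j + l)%N, (f * y0 ^+ l + g * y0 ^+ j); split.
  apply: dhomogD.
    by rewrite mulnDr; apply: dhomogM => //; exact: dhomogMn.
  by rewrite addnC mulnDr; apply: dhomogM => //; exact: dhomogMn.
rewrite rmorphD !rmorphM /= !rmorphXn exprD.
by rewrite addf_div ?expf_neq0.
Qed.

Let AM u v : A u -> A v -> A (u * v).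
Proof.
move=> [j [f [hf ->]]] [l [g [hg ->]]].
exists (j + l)%N, (f * g); split; first by rewrite mulnDr; exact: dhomogM.
by rewrite rmorphM exprD mulf_div.
Qed.

Let Aiota c : A (iota c).
Proof.
exists 0%N, c%:MP; split; last by rewrite expr0 divr1.
by rewrite muln0 -[c%:MP]mulr1 mul_mpolyC; apply: dhomogZ; exact: dhomog1.
Qed.

Let A1 : A 1. Proof. by rewrite -(rmorph1 iota). Qed.

Let AB u v : A u -> A v -> A (u - v).
Proof.
move=> Au Av; apply: AD => //; rewrite -mulN1r -(rmorph1 iota) -rmorphN.
exact: AM.
Qed.

Let Ax : A x.
Proof. by exists 1%N, y1; rewrite muln1 expr1. Qed.

(** Modulo the curve, a form of high degree is [y0 b + y1 c], so its fraction is
    [b/y0^j + x (c/y0^j)] with [b] and [c] of lower degree. This descends to degrees below [D],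
    where the monomials generate. *)
Lemma chart_finite : exists (T : finType) (a : T -> K),
  (forall t, A (a t)) /\ A `<=` lincomb (ev iota x) a.
Proof.
have [D [D0 hD]] := high_degree_in_parameters.
pose a (m : 'X_{1..r.+1 < D}) : K :=
  if (e.+1 %| mdeg m)%N then q 'X_[m] / q y0 ^+ (mdeg m %/ e.+1) else 0.
exists 'X_{1..r.+1 < D}, a; split=> [m|_ [j [f [hf ->]]]].
  rewrite /a; case: ifP => [em|_]; last by rewrite -(rmorph0 iota).
  exists (mdeg m %/ e.+1)%N, 'X_[m]; split=> //.
  by rewrite mulnC divnK // dhomogX.
have small d g : (d * e.+1 < D)%N -> g \is (e.+1 * d).-homog ->
    lincomb (ev iota x) a (q g / q y0 ^+ d).
  move=> dD hg; have -> : g = \sum_(m : 'X_{1..r.+1 < D}) g@_m *: 'X_[m].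
    apply: mpolywE; have [->|g0] := eqVneq g 0; first by rewrite msize0.
    rewrite -(mlead_deg g0).
    have -> : mdeg (mlead g) = _ := dhomog_mf hg (mlead_supp g0).
    by rewrite mulnC.
  rewrite rmorph_sum mulr_suml; apply: lincomb_sum => m _.
  have [md|md] := eqVneq (mdeg m) (e.+1 * d)%N; last first.
    rewrite (dhomog_nemf_coeff hg md) scale0r rmorph0 mul0r; exact: lincomb0.
  have am : a m = q 'X_[m] / q y0 ^+ d.
    by rewrite /a md dvdn_mulr // mulKn.
  rewrite -mul_mpolyC rmorphM /= -mulrA -am -[q _%:MP]/(iota _).
  rewrite -(horner_morphC (commr_field iota x)); apply: lincombZ.
  exact: lincomb_id.
elim: j f hf => [|j IHj] f hf; first by apply: small; rewrite ?mul0n.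
have [Dj|jD] := leqP D (e.+1 * j.+1); last by apply: small; rewrite // mulnC.
have [_ [u Iu [b ->]] [c fE]] := hD _ _ Dj hf.
have ej : (e.+1 <= e.+1 * j.+1)%N by rewrite leq_pmulr.
pose d := (e.+1 * j.+1)%N.
have dE : (d - e.+1 = e.+1 * j)%N by rewrite /d mulnS addKn.
have {}fE : f = part d u + y0 * part (e.+1 * j) b + y1 * part (e.+1 * j) c.
  rewrite -[LHS](pihomog_dE hf) fE !raddfD /= ![_ * y0]mulrC ![_ * y1]mulrC.
  by rewrite (pihomogM _ _ hy0) (pihomogM _ _ hy1) ej -/d dE.
have qu : q (part d u) = 0.
  apply/eqP; rewrite q_eq0.
  by have [_] := point_homogeneous (curve_point curve); apply.
rewrite fE !rmorphD /= qu add0r !rmorphM /= mulrDl exprS -!mulf_div divff // mul1r.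
apply: lincombD; first by apply: IHj; exact: pihomogP.
have /= xZ w : lincomb (ev iota x) a w -> lincomb (ev iota x) a (x * w).
  by move=> /(lincombZ 'X) /=; rewrite horner_morphX.
by apply: xZ; apply: IHj; exact: pihomogP.
Qed.


Let homogenize (c : {poly k}) m : S :=
  \sum_(i < m.+1) (c`_i)%:MP * (y1 ^+ i * y0 ^+ (m - i)).

Let homogenize_homog c m : homogenize c m \is (e.+1 * m).-homog.
Proof.
apply: rpred_sum => i _; rewrite mul_mpolyC; apply: dhomogZ.
have im : (i <= m)%N by rewrite -ltnS.
have <- : (e.+1 * i + e.+1 * (m - i) = e.+1 * m)%N by rewrite -mulnDr subnKC.
by apply: dhomogM; exact: dhomogMn.
Qed.

Let q_homogenize (c : {poly k}) m : (size c <= m.+1)%N ->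
  q (homogenize c m) = q y0 ^+ m * (map_poly iota c).[x].
Proof.
move=> cm; rewrite (@horner_coef_wide _ m.+1); last by rewrite size_map_poly.
rewrite rmorph_sum mulr_sumr; apply: eq_bigr => i _.
have im : (i <= m)%N by rewrite -ltnS.
rewrite !rmorphM !rmorphXn /= coef_map -[q _%:MP]/(iota _) [RHS]mulrCA; congr (_ * _).
have -> : q y0 ^+ m = q y0 ^+ (m - i) * q y0 ^+ i by rewrite -exprD subnK.
rewrite /x expr_div_n -mulrA [q y0 ^+ i * _]mulrC divfK ?expf_neq0 //.
exact: mulrC.
Qed.

(** Homogenize a relation of degree [m]: at [Q], where [y0] vanishes, only the term in [y1^m]
    remains, so [y1] would vanish there too. *)
Lemma parameter_transcendental :
  (exists2 Q, proj_points I Q & Q y0) -> ~ algebraicOver iota x.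
Proof.
move=> [Q ptQ Qy0] [c c0 /eqP cx]; have idQ := point_ideal ptQ.
pose m := (size c).-1.
have sc : size c = m.+1 by rewrite prednK // size_poly_gt0.
have := q_homogenize (eq_leq sc); rewrite cx mulr0 => /eqP.
rewrite q_eq0 => /(point_curve ptQ); rewrite /homogenize big_ord_recr /=.
rewrite subnn expr0 mulr1 => Qsum.
apply: (point_exp (n := m) ptQ (y01 ptQ Qy0)).
have cm : c`_m != 0 by rewrite -lead_coef_eq0 lead_coefE sc in c0.
rewrite -[y1 ^+ m]scale1r -(mulVf cm) -scalerA -!mul_mpolyC.
apply: ideal_mull => //.
rewrite -[_ * _](addKr (\sum_(i < m) (c`_i)%:MP * (y1 ^+ i * y0 ^+ (m - i)))) addrC.
apply: ideal_sub => //; apply: ideal_sum => // i _.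
apply: ideal_mull => //; apply: ideal_mull => //.
have : (0 < m - i)%N by rewrite subn_gt0.
by case: (m - i)%N => // n _; rewrite exprS; exact: ideal_mulr.
Qed.

Section AtPoint.
Variable Q : set S.
Hypothesis ptQ : proj_points I Q.
Hypothesis Qy0 : ~ Q y0.

(** The elements of the chart not vanishing at [Q]; inverting them yields the local ring at [Q]. *)
Let U : set K := [set z | exists j g,
  [/\ g \is (e.+1 * j).-homog, ~ Q g & z = q g / q y0 ^+ j]].

Let UA z : U z -> A z. Proof. by move=> [j [g [hg _ ->]]]; exists j, g. Qed.

Let U_neq0 z : U z -> z != 0.
Proof.
move=> [j [g [_ Qg ->]]]; have qg : q g != 0 by exact: (q_neq0 ptQ Qg).
by rewrite mulf_neq0 // invr_eq0 expf_neq0.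
Qed.

Let UM u v : U u -> U v -> U (u * v).
Proof.
move=> [j [f [hf Qf ->]]] [l [g [hg Qg ->]]].
exists (j + l)%N, (f * g); split.
- by rewrite mulnDr; exact: dhomogM.
- exact: (point_mul ptQ).
- by rewrite rmorphM exprD mulf_div.
Qed.

Let U1 : U 1.
Proof.
exists 0%N, 1; split; last by rewrite expr0 divr1 rmorph1.
- by rewrite muln0; exact: dhomog1.
- exact: point_nonunit ptQ.
Qed.

Let local_denominator z : stalk q Q z -> exists2 u, U u & A (u * z).
Proof.
move=> [d [f [g [_ hf hg Qg ->]]]]; have qg := q_neq0 ptQ Qg.
(* Numerator and denominator are multiplied by [g^e], which makes the degree of the denominator
   divisible by [e.+1]. *)
exists (q (g ^+ e.+1) / q y0 ^+ d).
  exists d, (g ^+ e.+1); split=> //; last exact: (point_exp ptQ).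
  by rewrite mulnC; exact: dhomogMn.
exists d, (f * g ^+ e); split.
  by rewrite mulSn; apply: dhomogM => //; rewrite mulnC; exact: dhomogMn.
rewrite !rmorphM !rmorphXn exprS; have := expf_neq0 d q0.
by move: (q g ^+ e) (q y0 ^+ d) => G Y Y0; field; rewrite Y0 qg.
Qed.

Let local_denominators n (z : nat -> K) : (forall i, stalk q Q (z i)) ->
  exists2 u, U u & forall i, (i < n)%N -> A (u * z i).
Proof.
move=> Lz; elim: n => [|n [u Uu hu]]; first by exists 1.
have [v Uv hv] := local_denominator (Lz n); exists (u * v); first exact: UM.
move=> i; rewrite ltnS leq_eqVlt => /predU1P [->|/hu h].
  by rewrite -mulrA; apply: AM => //; exact: UA.
by rewrite mulrAC; apply: AM => //; exact: UA.
Qed.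

(** Normalization commutes with localization: a common denominator [u] of the coefficients of an
    integral equation for [z] makes [u * z] integral over [A]. *)
Let normalization_chart z : normalization (stalk q Q) z ->
  exists2 u, U u & normalization A (u * z).
Proof.
move=> [[a [b [La Lb b0 ->]]] [p [mon_p Lp pz]]].
have [ua Ua Aa] := local_denominator La.
have [ub Ub Ab] := local_denominator Lb.
have [u Uu hu] := local_denominators (size p) Lp.
exists u => //; split.
  exists (u * ub * (ua * a)), (ua * (ub * b)); split.
  - by apply: AM => //; apply: AM; exact: UA.
  - by apply: AM => //; exact: UA.
  - by rewrite mulf_neq0 ?(U_neq0 Ua) // mulf_neq0 ?(U_neq0 Ub).
  - by have := U_neq0 Ua; have := U_neq0 Ub => ub0 ua0; field; rewrite ua0 ub0 b0.
have [mon_q qz] := scale_monic_root u mon_p pz.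
eexists; split; [exact: mon_q| |exact: qz] => i.
have AX v n : A v -> A (v ^+ n).
  by move=> Av; elim: n => [|n IHn]; rewrite ?expr0 // exprS; exact: AM.
rewrite coef_poly; case: ltnP => [ip|_]; last by rewrite -(rmorph0 iota).
have [->|iN] := eqVneq i (size p).-1.
  by rewrite subnn mulr1 -lead_coefE (monicP mon_p).
have {}iN : (i < (size p).-1)%N.
  by rewrite ltn_neqAle iN -ltnS (ltn_predK ip).
have -> : ((size p).-1 - i = ((size p).-1 - i).-1.+1)%N.
  by rewrite prednK // subn_gt0.
by rewrite exprS mulrA [p`_i * u]mulrC; apply: AM; [exact: hu|exact/AX/UA].
Qed.

(** Up to the element [y0^m / g] of the local ring, the multiplier is [c(x)]; this brings [u * z]
    into [A], and [u] is invertible at [Q]. *)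
Lemma chart_conductor_at (c : {poly k}) m : (size c <= m.+1)%N ->
  (forall z, normalization A z -> A ((map_poly iota c).[x] * z)) ->
  forall z g, normalization (stalk q Q) z ->
    g \is (e.+1 * m).-homog -> ~ Q g ->
    stalk q Q (q (homogenize c m) / q g * z).
Proof.
move=> cm hc z g /normalization_chart [u Uu /hc Acuz] hg Qg.
have u0 := U_neq0 Uu; have [j [G [hG QG uE]]] := Uu.
have [l [f [hf cuz]]] := Acuz.
exists (e.+1 * m + e.+1 * l + e.+1 * j)%N, (y0 ^+ m * f * y0 ^+ j), (g * y0 ^+ l * G).
have qg := q_neq0 ptQ Qg; have qG := q_neq0 ptQ QG.
split=> //.
- by do 2?apply: dhomogM => //; exact: dhomogMn.
- by do 2?apply: dhomogM => //; exact: dhomogMn.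
- by do 2?apply: (point_mul ptQ) => //; exact: (point_exp ptQ).
rewrite q_homogenize // !rmorphM !rmorphXn /=.
have cz : (map_poly iota c).[x] * z = q f / q y0 ^+ l / u.
  by rewrite -cuz mulrCA [u * _]mulrC mulfK.
rewrite mulrAC -[_ * _ * z]mulrA cz uE.
move: (expf_neq0 j q0) (expf_neq0 l q0) qg qG.
move: (q y0 ^+ m) (q y0 ^+ j) (q y0 ^+ l) (q f) (q g) (q G).
by move=> ym yj yl qf' qg' qG' yj0 yl0 g0 G0; field; rewrite yj0 yl0 g0 G0.
Qed.


End AtPoint.

Lemma chart_conductor : ~ algebraicOver iota x ->
  exists d C, [/\ C \is d.-homog, C \notin I
    & forall Q z g, proj_points I Q -> ~ Q y0 ->
        normalization (stalk q Q) z -> g \is d.-homog -> ~ Q g ->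
        stalk q Q (q C / q g * z)].
Proof.
move=> x_tr; have [T [a [Aa A_span]]] := chart_finite.
have [c c0 hc] := finite_normalization x_tr A1 AB AM Aiota Ax Aa A_span.
have cs : (size c <= (size c).+1)%N by [].
exists (e.+1 * size c)%N, (homogenize c (size c)); split.
- exact: homogenize_homog.
- rewrite -q_eq0 q_homogenize // mulf_neq0 ?expf_neq0 //.
  by apply/eqP => cx; apply: x_tr; exists c => //; exact/eqP.
- move=> Q z g ptQ Qy0 nz hg Qg.
  exact: (chart_conductor_at ptQ Qy0 cs hc nz hg Qg).
Qed.

End Chart.

(** * The adjoint ideal *)

Section Adjoint.
Variables (k : fieldType) (r : nat) (I : prime_idealr {mpoly k[r.+1]}).
Local Notation S := {mpoly k[r.+1]}.
Variables (K : fieldType) (q : {rmorphism S -> K}).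
Hypothesis q_eq0 : forall f, (q f == 0) = (f \in I).
Local Notation part := (pihomog mdeg).
Local Notation Iset := ([set f | f \in I] : set S).

Let q_neq0 P f : proj_points I P -> ~ P f -> q f != 0.
Proof. by move=> ptP /(point_notin ptP); rewrite q_eq0. Qed.

Section LocalRing.
Variable P : set S.
Hypothesis ptP : proj_points I P.

Lemma stalk_frac d f g : f \is d.-homog -> g \is d.-homog -> ~ P g ->
  stalk q P (q f / q g).
Proof. by move=> hf hg Pg; exists d, f, g. Qed.

Lemma stalkM u v : stalk q P u -> stalk q P v ->
  stalk q P (u * v).
Proof.
move=> [d [f [g [_ hf hg Pg ->]]]] [d' [f' [g' [_ hf' hg' Pg' ->]]]].
exists (d + d')%N, (f * f'), (g * g'); split=> //; try exact: dhomogM.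
  exact: (point_mul ptP).
by rewrite !rmorphM mulf_div.
Qed.

Lemma conductor_mul u v : stalk q P u -> conductor (stalk q P) v ->
  conductor (stalk q P) (u * v).
Proof.
move=> Lu [Lv hv]; split; first exact: stalkM.
by move=> z /hv h; rewrite -mulrA; exact: stalkM.
Qed.

End LocalRing.

Hypothesis curve : integral_curve I.

(** Take the product of the forms of the charts of [y0] and [y1]. Every point lies in one of the
    charts, whose form does the work there, while the other form only contributes an element of the
    local ring. *)
Lemma global_conductor : exists d C, [/\ C \is d.-homog, C \notin I
  & forall Q g, proj_points I Q -> g \is d.-homog -> ~ Q g ->
      conductor (stalk q Q) (q C / q g)].
Proof.
have [e [y0 [y1 [hy0 hy1 y0I [P ptP Py0] y01]]]] := exists_parameters curve.
have y1I : y1 \notin I by apply/negP => /(point_curve ptP); exact: y01.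
have y10 Q : proj_points I Q -> Q y1 -> ~ Q y0 by move=> ptQ Qy1 /(y01 Q ptQ).
have x_tr := parameter_transcendental q_eq0 y0I y01 (ex_intro2 _ _ P ptP Py0).
have [d [C [hC CI hd]]] := chart_conductor q_eq0 curve hy0 hy1 y0I y01 x_tr.
have [|d' [C' [hC' C'I hd']]] := chart_conductor q_eq0 curve hy1 hy0 y1I y10.
  by move=> /algebraic_inv; rewrite invf_div.
exists (d + d')%N, (C * C'); split; first exact: dhomogM.
  by rewrite prime_idealrM negb_or CI.
move=> Q g ptQ hg Qg; split.
  by apply: stalk_frac hg _ => //; exact: dhomogM.
move=> z nz; have [h hh Qh] := point_form ptQ d.
have [h' hh' Qh'] := point_form ptQ d'.
have qh := q_neq0 ptQ Qh; have qh' := q_neq0 ptQ Qh'.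
have qg := q_neq0 ptQ Qg.
have [Qy0|Qy0] := pselect (Q y0).
  have -> : q (C * C') / q g * z = q (C * h') / q g * (q C' / q h' * z).
    by rewrite !rmorphM; field; rewrite qg qh'.
  apply: stalkM => //; last exact: hd' (y01 Q ptQ Qy0) nz hh' Qh'.
  by apply: stalk_frac hg _ => //; exact: dhomogM.
have -> : q (C * C') / q g * z = q (h * C') / q g * (q C / q h * z).
  by rewrite !rmorphM; field; rewrite qg qh.
apply: stalkM => //; last exact: hd Qy0 nz hh Qh.
by apply: stalk_frac hg _ => //; exact: dhomogM.
Qed.

Definition adjoint_forms (W : set (set S)) : set S :=
  [set f | forall P, W P -> forall d g, g \is d.-homog -> ~ P g ->
     conductor (stalk q P) (q (part d f) / q g)].

Lemma adjoint_forms_bigcap (W : set (set S)) :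
  adjoint_forms W = \bigcap_(P in W) adjoint_forms [set P].
Proof.
apply/seteqP; split=> [f hf P WP _ ->|f hf P WP]; first exact: hf.
by apply: (hf P WP).
Qed.

Section Points.
Variable W : set (set S).
Hypothesis closedW : W `<=` closed_points I.

Lemma conductor0 P : proj_points I P -> conductor (stalk q P) 0.
Proof.
move=> ptP; have L0 : stalk q P 0.
  exists 0%N, 0, 1; split=> //;
    [exact: dhomog0|exact: dhomog1|exact: point_nonunit ptP|].
  by rewrite rmorph0 mul0r.
by split=> // z _; rewrite mul0r.
Qed.

Lemma conductorD P u v : proj_points I P -> conductor (stalk q P) u ->
  conductor (stalk q P) v -> conductor (stalk q P) (u + v).
Proof.
move=> ptP; have LD w w' : stalk q P w -> stalk q P w' -> stalk q P (w + w').
  move=> [d [f [g [_ hf hg Pg ->]]]] [d' [f' [g' [_ hf' hg' Pg' ->]]]].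
  exists (d + d')%N, (f * g' + f' * g), (g * g'); split=> //.
  - by apply: dhomogD; [|rewrite addnC]; exact: dhomogM.
  - exact: dhomogM.
  - exact: (point_mul ptP).
  by rewrite rmorphD !rmorphM addf_div //; exact: q_neq0 ptP _.
move=> [Lu hu] [Lv hv]; split; first exact: LD.
by move=> z nz; rewrite mulrDl; apply: LD; [exact: hu|exact: hv].
Qed.

Lemma adjoint_forms_homogeneous : homogeneous_ideal (adjoint_forms W).
Proof.
split; last first.
  move=> f d hf P WP e g hg Pg.
  rewrite (@pihomog_homog _ _ d e) ?pihomogP //; case: eqP => [de|_].
    by rewrite de; exact: hf.
  by rewrite rmorph0 mul0r; apply: conductor0; have [] := closedW WP.
split=> //.
- move=> P WP d g hg Pg; rewrite pihomog0 rmorph0 mul0r.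
  by apply: conductor0; have [] := closedW WP.
- move=> f g hf hg' P WP d h hh Ph; have [ptP _] := closedW WP.
  rewrite pihomogD rmorphD mulrDl; apply: conductorD => //.
    exact: hf.
  exact: hg'.
move=> a f _ hf P WP d g hg Pg; have [ptP _] := closedW WP.
have C0 := conductor0 ptP; have CD u v := @conductorD P u v ptP.
rewrite pihomogM_sum rmorph_sum mulr_suml.
(* The form [h] splits the fraction into an element of the local ring and one of the conductor. *)
apply: big_ind => // i id; have [h hh Ph] := point_form ptP (d - i).
have qh := q_neq0 ptP Ph; have qg := q_neq0 ptP Pg.
have -> : q (part i a * part (d - i) f) / q g =
    q (part i a * h) / q g * (q (part (d - i) f) / q h).
  by rewrite !rmorphM; field; rewrite qg qh.
apply: conductor_mul => //; last exact: hf.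
apply: stalk_frac hg Pg.
by rewrite -(subnKC id); apply: dhomogM => //; exact: pihomogP.
Qed.

Lemma adjoint_forms_local P : W P ->
  stalk_ideal q P (adjoint_forms W) = conductor (stalk q P).
Proof.
move=> WP; have [ptP clP] := closedW WP.
apply/seteqP; split=> [_ [d [f [g [Wf hf hg Pg ->]]]]|z Cz].
  by rewrite -(pihomog_dE hf); exact: Wf.
have [[d [f [g [_ hf hg Pg zE]]]] _] := Cz.
have [e [C [hC CI hcond]]] := global_conductor.
have [m [t [ht Pt hsep]]] := separating_form curve hC CI ptP.
have qt := q_neq0 ptP Pt; have qg := q_neq0 ptP Pg.
exists (m + d)%N, (t * f), (t * g); split; try exact: dhomogM.
(* At [P] itself the fraction is a multiple of [z]; at another [Q] some form [p] of [P] is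
   invertible, which makes [t] a multiple of [C] there. *)
- move=> Q WQ n h hh Qh; have [ptQ clQ] := closedW WQ.
  have qh := q_neq0 ptQ Qh.
  rewrite (@pihomog_homog _ _ (m + d)) ?dhomogM //; case: eqP => [nE|_]; last first.
    by rewrite rmorph0 mul0r; exact: conductor0.
  subst n; have [QP|QP] := pselect (Q = P).
    subst Q; have -> : q (t * f) / q h = q (t * g) / q h * z.
      by rewrite zE !rmorphM; field; rewrite qh qg.
    by apply: conductor_mul => //; apply: stalk_frac hh Qh; exact: dhomogM.
  have [|d' [p [N [hp Pp Qp tpN]]]] := hsep Q (point_ideal ptQ).
    by move=> PQ; apply: QP; exact: clP.
  have [u Iu [a tE]] := tpN.
  have [w hw Qw] := point_form ptQ e.
  have qw := q_neq0 ptQ Qw; have qp := q_neq0 ptQ Qp.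
  have htp : t * p ^+ N \is (m + d' * N).-homog.
    by apply: dhomogM => //; exact: dhomogMn.
  (* Only this component of [a] contributes to [a * C] in degree [m + d' * N]; below the degree [e]
     of [C] there is none. *)
  pose a' := if (e <= m + d' * N)%N then part (m + d' * N - e) a else 0.
  have qtE : q t * q p ^+ N = q a' * q C.
    rewrite -rmorphXn -!rmorphM -(pihomog_dE htp) tE raddfD /= [a * C]mulrC.
    rewrite (pihomogM _ _ hC) rmorphD.
    have -> : q (part (m + d' * N) u) = 0.
      apply/eqP; rewrite q_eq0.
      by have [_] := point_homogeneous (curve_point curve); apply.
    by rewrite add0r /a'; case: ifP => _; rewrite ?mul0r // mulrC.
  have -> : q (t * f) / q h = q (a' * w * f) / q (p ^+ N * h) * (q C / q w).
    have qpN := expf_neq0 N qp.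
    rewrite !rmorphM rmorphXn.
    have -> : q t = q a' * q C / q p ^+ N by rewrite -qtE mulfK.
    move: (q p ^+ N) qpN => pN qpN.
    by field; rewrite qh qw qpN.
  rewrite /a'; case: leqP => em; last first.
    by rewrite !mul0r rmorph0 !mul0r; exact: conductor0.
  apply: conductor_mul => //; last exact: hcond.
  apply: (@stalk_frac _ (d' * N + (m + d))).
  + have <- : (m + d' * N - e + e + d = d' * N + (m + d))%N.
      by rewrite subnK // -addnA addnCA.
    by do 2?apply: dhomogM => //; exact: pihomogP.
  + by apply: dhomogM => //; exact: dhomogMn.
  + by apply: (point_mul ptQ) => //; exact: (point_exp ptQ).
- exact: (point_mul ptP).
- by rewrite zE !rmorphM; field; rewrite qt qg.
Qed.

End Points.
End Adjoint.

(** * The fraction field of the coordinate ring, and the theorem *)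

Section CoordinateMap.
Variables (k : fieldType) (r : nat) (I : prime_idealr {mpoly k[r.+1]}).

Definition coordK : {mpoly k[r.+1]} -> {fraction {ideal_quot I}} :=
  @FracField.tofrac {ideal_quot I} \o \pi_({ideal_quot I}).

HB.instance Definition _ := GRing.RMorphism.on coordK.

Lemma coordK_eq0 f : (coordK f == 0) = (f \in I).
Proof.
rewrite tofrac_eq0 -(rmorph0 \pi_({ideal_quot I})) /=.
by rewrite -[in RHS](subr0 f) Quotient.idealrBE.
Qed.

End CoordinateMap.

(** Maximality is built into [adjoint_forms]: for a competing [J], the fractions tested there belong
    to the localization of [J], which is the conductor. *)
Lemma gorenstein_adjointE (k : fieldType) (r : nat)
    (I : prime_idealr {mpoly k[r.+1]}) (W : set (set {mpoly k[r.+1]})) :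
  integral_curve I -> W `<=` closed_points I ->
  gorenstein_adjoint I W = adjoint_forms (coordK I) W.
Proof.
move=> curve closedW; apply: gorenstein_adjoint_eq; split.
  split; first exact: (adjoint_forms_homogeneous (coordK_eq0 I) closedW).
  by move=> P WP; exact: (adjoint_forms_local (coordK_eq0 I) curve closedW WP).
move=> J [[_ homJ] locJ] f Jf P WP d g hg Pg.
rewrite -[stalk _ P]/(@local_ring _ _ I P) -locJ //.
by exists d, (pihomog mdeg d f), g; split=> //; [exact: homJ|exact: pihomogP].
Qed.

Theorem proposition5p4 (k : fieldType) (r : nat)
    (I : prime_idealr {mpoly k[r.+1]}) (W : set (set {mpoly k[r.+1]})) :
  integral_curve I -> nondegenerate_curve I -> W `<=` singular_points I ->
  gorenstein_adjoint I W = \bigcap_(P in W) gorenstein_adjoint I [set P].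
Proof.
move=> curve _ singW.
have closedW : W `<=` closed_points I by move=> P /singW [].
rewrite (gorenstein_adjointE curve closedW) adjoint_forms_bigcap.
apply: eq_bigcapr => P WP; rewrite gorenstein_adjointE // => _ ->; exact: closedW.
Qed.
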